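(* Let $\mathcal{T}\in\mathbb{R}^{R\times R\times K}$ be a slice mix invertible tensor of real rank $R$, let $1\le J\le R$, let $\mathbf{U}\in\mathbb{R}^{K\times K}$ be any orthogonal matrix, and set $\mathcal{S}=\mathcal{T}\cdot_3\mathbf{U}$ with frontal slices $\mathbf{S}_1,\dots,\mathbf{S}_K$. For each $k=1,\dots,\lfloor K/2\rfloor$, let $\epsilon_k\ge 0$ be the $J$-eigenvalue bound (defined in the context) of the pencil $(\mathbf{S}_{2k-1},\mathbf{S}_{2k})$, where $\epsilon_k=0$ if this pencil is not slice mix invertible. Set $\epsilon=\|(\epsilon_1,\dots,\epsilon_{\lfloor K/2\rfloor})\|_2$. Then every tensor $\mathcal{Y}\in\mathbb{R}^{R\times R\times K}$ with $\|\mathcal{T}-\mathcal{Y}\|_{\mathrm F}<\epsilon$ has a subpencil which has at least $J$ distinct (possibly complex valued) generalized eigenvalues.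
   Context: Let $\mathbb{K}$ be $\mathbb{R}$ or $\mathbb{C}$. For a tensor $\mathcal{M}\in\mathbb{K}^{R\times R\times K}$, the frontal slices are the matrices $\mathbf{M}_k=\mathcal{M}(:,:,k)$, $k=1,\dots,K$. For $\mathbf{U}\in\mathbb{K}^{L\times K}$, the mode-3 product $\mathcal{M}\cdot_3\mathbf{U}\in\mathbb{K}^{R\times R\times L}$ is the tensor whose $\ell$th frontal slice is $\sum_k u_{\ell k}\mathbf{M}_k$; the mode-1 and mode-2 products are analogous. $\mathcal{M}$ is slice mix invertible if $\mathcal{M}\cdot_3\mathbf{v}^{\mathrm T}=\sum_k v_k\mathbf{M}_k$ is invertible for some $\mathbf{v}\in\mathbb{R}^K$. A pencil is a tensor of size $R\times R\times 2$; $(\mathbf{M}_1,\mathbf{M}_2)$ denotes the pencil with these frontal slices. A subpencil of $\mathcal{Y}\in\mathbb{R}^{R\times R\times K}$ is a tensor $\mathcal{Y}\cdot_3\mathbf{V}$ with $\mathbf{V}\in\mathbb{R}^{2\times K}$ of rank 2. $\|\cdot\|_{\mathrm F}$ is the Frobenius norm (square root of the sum of squared entries). $[\![\mathbf{A},\mathbf{B},\mathbf{C}]\!]$ denotes the tensor with $(i,j,k)$ entry $\sum_{r=1}^R a_{ir}b_{jr}c_{kr}$. The real rank of a tensor is the minimal $R$ for which it can be so written with real factor matrices having $R$ columns, and such a minimal expression is a canonical polyadic decomposition (CPD). For a pencil $\mathcal{M}$, a one-dimensional subspace $\mathrm{span}(\lambda)\subset\mathbb{K}^2$ is a generalized eigenvalue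 (over $\mathbb{K}$) if there are nonzero $\mathbf{z},\mathbf{q}\in\mathbb{K}^R$ with $\mathbf{M}_k\mathbf{z}=\lambda_k\mathbf{q}$ for $k=1,2$; ''possibly complex valued'' means $\mathbb{K}=\mathbb{C}$. For nonzero $\lambda\in\mathbb{R}^2$, $\theta(\lambda)\in[0,\pi)$ is the angle with $\mathrm{span}(\lambda)=\mathrm{span}\big((\cos\theta(\lambda),\sin\theta(\lambda))\big)$, and $\chi(\lambda,\mu)$ is the sine of the principal angle between $\mathrm{span}(\lambda)$ and $\mathrm{span}(\mu)$. The spectral norm of $\mathcal{M}$ is $\|\mathcal{M}\|_{\mathrm{sp}}=\max|\mathcal{M}\cdot_1\mathbf{x}^{\mathrm T}\cdot_2\mathbf{y}^{\mathrm T}\cdot_3\mathbf{z}^{\mathrm T}|$ over complex vectors of compatible dimension with unit Euclidean norm. $\sigma_{\min}$ is the smallest singular value. $J$-eigenvalue bound of a pencil: let $\mathcal{P}\in\mathbb{R}^{R\times R\times 2}$ be slice mix invertible of real rank $R$ (each slice mix invertible pencil $(\mathbf{S}_{2k-1},\mathbf{S}_{2k})$ as in the claim has real rank $R$), and fix a real CPD $\mathcal{P}=[\![\mathbf{A},\mathbf{B},\mathbf{C}]\!]$ with unit-norm columns of $\mathbf{C}$ (any such choice is allowed). The generalized eigenvalues of $\mathcal{P}$, listed with multiplicity, are the spans of the columns of $\mathbf{C}$; write them $\mathrm{span}(\lambda_1),\dots,\mathrm{span}(\lambda_R)$ ordered so that $0\le\theta(\lambda_1)\le\dots\le\theta(\lambda_R)<\pi$,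 and put $\lambda_{R+1}=\lambda_1$. Let $\delta$ be the $J$th largest element, counted with multiplicity, of the family $\{\chi(\lambda_r,\lambda_{r+1})/2\}_{r=1}^R$. The bound is $\min\{\sigma_{\min}(\mathbf{A})\sigma_{\min}(\mathbf{B})\delta,\ d\}$, where $d$ is the distance in the spectral norm from $\mathcal{P}$ to the nearest pencil in $\mathbb{R}^{R\times R\times 2}$ which is not slice mix invertible. *)

(* Defs.v *)
From mathcomp Require Import all_boot all_order all_algebra.
From mathcomp Require Import complex.
From mathcomp Require Import classical_sets reals trigo.
Set Implicit Arguments.
Unset Strict Implicit.
Unset Printing Implicit Defensive.
Import Order.TTheory GRing.Theory Num.Theory.
Local Open Scope ring_scope.
Local Open Scope complex_scope.
Local Open Scope classical_set_scope.

(* A tensor of size m x n x p is given by its frontal slices: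
   the (i, j, k) entry of M is M k i j. *)
Notation tensor K m n p := {ffun 'I_p -> 'M[K]_(m, n)}.

Section Tensors.
Variable K : fieldType.

Definition mode1 m n p l (M : tensor K m n p) (X : 'M[K]_(l, m)) :
  tensor K l n p := [ffun k => X *m M k].

Definition mode2 m n p l (M : tensor K m n p) (Y : 'M[K]_(l, n)) :
  tensor K m l p := [ffun k => M k *m Y^T].

Definition mode3 m n p l (M : tensor K m n p) (U : 'M[K]_(l, p)) :
  tensor K m n l := [ffun i => \sum_k U i k *: M k].

Definition cpd_tensor m n p r (A : 'M[K]_(m, r)) (B : 'M[K]_(n, r))
    (C : 'M[K]_(p, r)) : tensor K m n p :=
  [ffun k => \matrix_(i, j) \sum_(s < r) A i s * B j s * C k s].

Definition tensor_rank m n p (T : tensor K m n p) (r : nat) : Prop :=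
  (exists A B C, T = @cpd_tensor m n p r A B C) /\
  (forall r', (exists A B C, T = @cpd_tensor m n p r' A B C) -> (r <= r')%N).

Definition is_cpd m n p r (T : tensor K m n p) (A : 'M[K]_(m, r))
    (B : 'M[K]_(n, r)) (C : 'M[K]_(p, r)) : Prop :=
  tensor_rank T r /\ T = cpd_tensor A B C.

Definition gen_eigenvalue n (M : tensor K n n 2)
    (L : {vspace 'cV[K]_2}) : Prop :=
  exists lam : 'cV[K]_2, [/\ lam != 0, L = <[lam]>%VS &
    exists z q : 'cV[K]_n,
      [/\ z != 0, q != 0 & forall k, M k *m z = lam k 0 *: q]].

Definition at_least_gen_eigenvalues n (J : nat) (M : tensor K n n 2) : Prop :=
  exists s : seq {vspace 'cV[K]_2},
    [/\ uniq s, (J <= size s)%N & forall L, L \in s -> gen_eigenvalue M L].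

Definition subpencil m n p (P : tensor K m n 2) (Y : tensor K m n p) : Prop :=
  exists2 V : 'M[K]_(2, p), \rank V = 2%N & P = mode3 Y V.

Lemma slice_pair_subproof p (k : 'I_p./2) (j : 'I_2) : (k.*2 + j < p)%N.
Proof.
apply: (@leq_trans k.+1.*2); first by case: j => j /= j2; rewrite doubleS -addn2 -addnS leq_add2l.
by rewrite -[leqRHS]odd_double_half (leq_trans _ (leq_addl _ _)) ?leq_double.
Qed.

(* The k-th pencil of consecutive slices, with k and the slices counted
   from 0. *)
Definition slice_pair m n p (S : tensor K m n p) (k : 'I_p./2) :
  tensor K m n 2 := [ffun j => S (Ordinal (slice_pair_subproof k j))].

End Tensors.

Section RealTensors.
Variable F : realType.

Definition slice_mix_invertible n p (M : tensor F n n p) : Prop :=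
  exists v : 'cV[F]_p, mode3 M v^T 0 \in unitmx.

Definition frobenius_norm m n p (M : tensor F m n p) : F :=
  Num.sqrt (\sum_k \sum_i \sum_j M k i j ^+ 2).

Definition complexify m n p (M : tensor F m n p) : tensor F[i] m n p :=
  [ffun k => map_mx (real_complex F) (M k)].

Definition euclid_norm n (x : 'cV[F]_n) : F :=
  Num.sqrt (\sum_i x i 0 ^+ 2).

Definition euclid_normC n (x : 'cV[F[i]]_n) : F :=
  Num.sqrt (\sum_i Normc.normc (x i 0) ^+ 2).

(* The supremum is attained (compactness), hence a maximum. *)
Definition spectral_norm m n p (M : tensor F[i] m n p) : F :=
  sup [set t | exists (x : 'cV[F[i]]_m) (y : 'cV[F[i]]_n) (z : 'cV[F[i]]_p),
    [/\ euclid_normC x = 1, euclid_normC y = 1, euclid_normC z = 1 &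
        t = Normc.normc (mode3 (mode2 (mode1 M x^T) y^T) z^T 0 0 0)]].

Definition singular_value n (A : 'M[F]_n) (s : F) : Prop :=
  0 <= s /\ eigenvalue (A^T *m A) (s ^+ 2).

Definition sigma_min n (A : 'M[F]_n) : F := inf [set s | singular_value A s].

Definition unit_direction (t : F) : 'cV[F]_2 :=
  \col_k (if k == 0 then cos t else sin t).

Definition theta (lam : 'cV[F]_2) : F :=
  xget 0 [set t : F | 0 <= t < pi /\ <[lam]>%VS = <[unit_direction t]>%VS].

(* Sine of the principal angle, in [0, pi/2], between two lines. *)
Definition chi (lam mu : 'cV[F]_2) : F :=
  sin (acos (`|\sum_k lam k 0 * mu k 0| / (euclid_norm lam * euclid_norm mu))).

Definition sorted_columns n (C : 'M[F]_(2, n)) : seq 'cV[F]_2 :=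
  sort (fun lam mu => theta lam <= theta mu) [seq col r C | r <- enum 'I_n].

(* Rotating the sequence by one implements lambda_(n+1) = lambda_1. *)
Definition half_gaps n (C : 'M[F]_(2, n)) : seq F :=
  let s := sorted_columns C in [seq chi x.1 x.2 / 2 | x <- zip s (rot 1 s)].

(* The J-th largest entry with multiplicity, for 1 <= J <= size s. *)
Definition nth_largest (J : nat) (s : seq F) : F :=
  nth 0 (sort (fun x y => y <= x) s) J.-1.

Definition dist_not_slice_mix_invertible n (P : tensor F n n 2) : F :=
  inf [set spectral_norm (complexify (P - Q)) | Q in
        [set Q : tensor F n n 2 | ~ slice_mix_invertible Q]].

(* The bound depends on the chosen CPD: e is the bound for some choice.  It is
   0 by convention when P is not slice mix invertible. *)
Definition J_eigenvalue_bound n (J : nat) (P : tensor F n n 2) (e : F) : Prop :=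
  (slice_mix_invertible P /\
   exists A B C, [/\ is_cpd P A B (C : 'M[F]_(2, n)),
     forall r, euclid_norm (col r C) = 1 &
     e = Num.min (sigma_min A * sigma_min B * nth_largest J (half_gaps C))
                 (dist_not_slice_mix_invertible P)])
  \/ (~ slice_mix_invertible P /\ e = 0).

End RealTensors.

(* Main.v *)
Require Import Defs.
From mathcomp Require Import all_boot all_order all_algebra.
From mathcomp Require Import perm complex.
From mathcomp Require Import classical_sets reals trigo.
From mathcomp Require Import ring lra zify.
Import Order.TTheory GRing.Theory Num.Theory.
Local Open Scope ring_scope.
Set Implicit Arguments.
Unset Strict Implicit.
Unset Printing Implicit Defensive.

(* Rotating the slices by U preserves the Frobenius distance, and the pencils of
   consecutive slices are disjoint parts of the rotated tensor, so for some k
   the k-th pencil Q of the rotated Y is closer than eps_k to the k-th pencil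
   P = [[A, B, C]] of the rotated T.  The rest is a Bauer-Fike argument on the
   Riemann sphere.  At a unit vector mu of C^2 the matrix mu_2 P_1 - mu_1 P_2 is
   A diag(det(mu, c_r)) B^T, whose smallest singular value is at least
   sigma_min(A) sigma_min(B) min_r |det(mu, c_r)|.  Hence along the segment from
   P to Q all eigenvalues stay at chordal distance < delta from the lines of P,
   which the J gaps of size >= 2 delta split into at least J clusters.  Zeros of
   a polynomial move continuously, so none of them can jump to another cluster,
   and at Q every cluster still contains an eigenvalue.  The point (1 : i) is at
   distance 1 / sqrt 2 > delta from all real lines; it is never an eigenvalue and
   serves as the point at infinity. *)

(** * Norms and the smallest singular value *)

Section LinAlg.
Local Open Scope complex_scope.
Variable F : realType.
Local Notation C := F[i].
Local Notation nc := (@Normc.normc F).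
Local Notation toC := (map_mx (real_complex F)).

Definition norm2 n (v : 'cV[C]_n) : F := \sum_i nc (v i 0) ^+ 2.

Lemma normc_ge0 (x : C) : 0 <= nc x.
Proof. by case: x => a b; rewrite /nc sqrtr_ge0. Qed.

Lemma sqr_normcE (a b : F) : nc (a +i* b) ^+ 2 = a ^+ 2 + b ^+ 2.
Proof. by rewrite /nc sqr_sqrtr // addr_ge0 // sqr_ge0. Qed.

Lemma normc_real (a : F) : nc a%:C = `|a|.
Proof. by rewrite /= expr0n /= addr0 sqrtr_sqr. Qed.

Lemma normrE_normc (x : C) : `|x| = (nc x)%:C.
Proof. by case: x. Qed.

Lemma normc_eq0 (x : C) : (nc x == 0) = (x == 0).
Proof.
apply/eqP/eqP => [/Normc.eq0_normc//|->]; exact: Normc.normc0.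
Qed.

Lemma normc_sum I (r : seq I) (P : pred I) (f : I -> C) :
  nc (\sum_(i <- r | P i) f i) <= \sum_(i <- r | P i) nc (f i).
Proof.
elim/big_rec2: _ => [|i x y _ h]; first by rewrite Normc.normc0.
by apply: le_trans (le_normcD _ _) _; rewrite lerD2l.
Qed.

Lemma normc_prod I (r : seq I) (P : pred I) (f : I -> C) :
  nc (\prod_(i <- r | P i) f i) = \prod_(i <- r | P i) nc (f i).
Proof.
by apply: (big_morph _ (@Normc.normcM F)); rewrite Normc.normc1.
Qed.

Lemma sqr_normcD_le (a b : C) : nc (a + b) ^+ 2 <= 2 * (nc a ^+ 2 + nc b ^+ 2).
Proof.
by case: a b => a1 a2 [b1 b2]; rewrite !sqr_normcE;
have := sqr_ge0 (a1 - b1); have := sqr_ge0 (a2 - b2); nra.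
Qed.

(** Lagrange's identity: the difference of the two sides is half the double sum of the squares of
    the minors [x i * y j - x j * y i]. *)
Lemma Cauchy_Schwarz I (r : seq I) (x y : I -> F) :
  (\sum_(i <- r) x i * y i) ^+ 2 <=
  (\sum_(i <- r) x i ^+ 2) * (\sum_(i <- r) y i ^+ 2).
Proof.
rewrite -subr_ge0.
have -> : (\sum_(i <- r) x i ^+ 2) * (\sum_(i <- r) y i ^+ 2) -
   (\sum_(i <- r) x i * y i) ^+ 2 =
   2^-1 * \sum_(i <- r) \sum_(j <- r) (x i * y j - x j * y i) ^+ 2.
  have E : \sum_(i <- r) \sum_(j <- r) (x i * y j - x j * y i) ^+ 2 =
      \sum_(i <- r) \sum_(j <- r) (x i ^+ 2 * y j ^+ 2) +
      \sum_(j <- r) \sum_(i <- r) (x i ^+ 2 * y j ^+ 2) -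
      2 * \sum_(i <- r) \sum_(j <- r) (x i * y i) * (x j * y j).
    rewrite mulr_sumr -big_split /= -sumrB; apply: eq_bigr => i _.
    rewrite mulr_sumr -big_split /= -sumrB; apply: eq_bigr => j _; ring.
  by rewrite E [X in _ + X - _]exchange_big /= expr2 !big_distrlr /=; field.
by rewrite mulr_ge0 ?invr_ge0 // sumr_ge0 // => i _; rewrite sumr_ge0 // => j _; rewrite sqr_ge0.
Qed.

Lemma Cauchy_SchwarzC I (r : seq I) (a v : I -> C) :
  nc (\sum_(i <- r) a i * v i) ^+ 2 <=
  (\sum_(i <- r) nc (a i) ^+ 2) * (\sum_(i <- r) nc (v i) ^+ 2).
Proof.
apply: le_trans (Cauchy_Schwarz _ _ _); rewrite ler_sqr ?nnegrE ?normc_ge0 //.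
  apply: le_trans (normc_sum _ _ _) _.
  by rewrite le_eqVlt; apply/orP; left; apply/eqP; apply: eq_bigr => i _; rewrite Normc.normcM.
by rewrite sumr_ge0 // => i _; rewrite mulr_ge0 ?normc_ge0.
Qed.

Lemma norm2_ge0 n (v : 'cV[C]_n) : 0 <= norm2 v.
Proof. by rewrite sumr_ge0 // => i _; rewrite sqr_ge0. Qed.

Lemma norm2_eq0 n (v : 'cV[C]_n) : (norm2 v == 0) = (v == 0).
Proof.
apply/eqP/eqP => [/eqP|->]; last first.
  by rewrite /norm2 big1 // => i _; rewrite mxE Normc.normc0 expr0n.
rewrite psumr_eq0 => [/allP h|i _]; last by rewrite sqr_ge0.
apply/colP => i; rewrite mxE; apply/eqP.
by have := h i (mem_index_enum _); rewrite sqrf_eq0 normc_eq0.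
Qed.

Lemma norm2N n (v : 'cV[C]_n) : norm2 (- v) = norm2 v.
Proof. by apply: eq_bigr => i _; rewrite mxE normcN. Qed.

Lemma norm2Z n (a : C) (v : 'cV[C]_n) : norm2 (a *: v) = nc a ^+ 2 * norm2 v.
Proof. by rewrite /norm2 mulr_sumr; apply: eq_bigr => i _; rewrite mxE Normc.normcM exprMn. Qed.

Lemma norm2D_le n (u v : 'cV[C]_n) : norm2 (u + v) <= 2 * (norm2 u + norm2 v).
Proof.
rewrite /norm2 -big_split mulr_sumr; apply: ler_sum => i _.
by rewrite mxE sqr_normcD_le.
Qed.

Lemma norm2_mulmx_le m n (M : 'M[C]_(m, n)) v :
  norm2 (M *m v) <= (\sum_i \sum_j nc (M i j) ^+ 2) * norm2 v.
Proof.
rewrite mulr_suml; apply: ler_sum => i _; rewrite mxE; exact: Cauchy_SchwarzC.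
Qed.

Lemma norm2_diag_ge n (d : 'rV[C]_n) (m : F) v :
  (forall r, m <= nc (d 0 r) ^+ 2) -> m * norm2 v <= norm2 (diag_mx d *m v).
Proof.
move=> h; rewrite mulr_sumr; apply: ler_sum => i _.
by rewrite mul_diag_mx mxE Normc.normcM exprMn ler_wpM2r ?sqr_ge0.
Qed.

Lemma norm2E n (v : 'cV[C]_n) : (norm2 v)%:C = \sum_i `|v i 0| ^+ 2.
Proof.
by rewrite rmorph_sum; apply: eq_bigr => i _; rewrite normrE_normc rmorphXn.
Qed.

Lemma norm2_dot n (v : 'cV[C]_n) :
  (norm2 v)%:C = (map_mx Num.conj v^T *m v) 0 0.
Proof.
by rewrite norm2E mxE; apply: eq_bigr => i _; rewrite !mxE normCK mulrC.
Qed.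

Lemma lerC (a b : F) : (a%:C <= b%:C) = (a <= b).
Proof. by rewrite lecE /= eqxx. Qed.

Lemma sigma_min_ge0 n (A : 'M[F]_n) : 0 <= sigma_min A.
Proof.
rewrite /sigma_min.
(* The set is empty for [n = 0], and the infimum of the empty set is 0. *)
have [->|/set0P h] := eqVneq [set s | singular_value A s]%classic set0; first by rewrite inf0.
by apply: lb_le_inf => // s [].
Qed.

Lemma sigma_min_le n (A : 'M[F]_n) s : singular_value A s -> sigma_min A <= s.
Proof. by move=> h; apply: ge_inf => //; exists 0 => t []. Qed.

(** An eigenvector [v] of [B *m B^T] yields the eigenvector [v *m B] of [B^T *m B] for the same
    eigenvalue. If [v *m B = 0], the eigenvalue is 0 and [B] is singular, so 0 is an eigenvalue of
    [B^T *m B] too. *)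
Lemma sigma_min_trmx n (A : 'M[F]_n) : sigma_min A^T = sigma_min A.
Proof.
suff h (B : 'M[F]_n) s : singular_value B^T s -> singular_value B s.
  congr (inf _); apply/seteqP; split => s /=; first exact: h.
  by rewrite -{1}(trmxK A); exact: h.
rewrite /singular_value trmxK => -[s0 /eigenvalueP [v /= hv v0]]; split=> //.
have [vB|vB] := eqVneq (v *m B) 0; last first.
  by apply/eigenvalueP; exists (v *m B) => //; rewrite mulmxA -(mulmxA v) hv scalemxAl.
have s2 : s ^+ 2 = 0.
  apply/eqP; move/eqP: hv; rewrite mulmxA vB mul0mx eq_sym scaler_eq0.
  by rewrite (negbTE v0) orbF.
have : \det B = 0.
  apply/eqP/negP => /negP d0; move/negP: v0; apply.
  have u : B \in unitmx by rewrite unitmxE unitfE.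
  by rewrite -[v](mulmxK u) vB mul0mx.
rewrite s2 => dB.
have : \det (B^T *m B) = 0 by rewrite det_mulmx dB mulr0.
move=> /eqP /det0P [w w0 hw].
by apply/eigenvalueP; exists w => //; rewrite hw scale0r.
Qed.

Lemma conj_trmx_toC m n (A : 'M[F]_(m, n)) :
  map_mx Num.conj (toC A)^T = toC A^T.
Proof. by apply/matrixP => i j; rewrite !mxE /= conj_Creal // complex_real. Qed.

Lemma norm2_toC_mulmx n (A : 'M[F]_n) (v : 'cV[C]_n) :
  (norm2 (toC A *m v))%:C =
  (map_mx Num.conj v^T *m (toC (A^T *m A)) *m v) 0 0.
Proof.
by rewrite norm2_dot trmx_mul map_mxM /= conj_trmx_toC map_mxM !mulmxA.
Qed.

Lemma conj_trmxK m n (A : 'M[C]_(m, n)) :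
  map_mx Num.conj (map_mx Num.conj A^T)^T = A.
Proof. by apply/matrixP => i j; rewrite !mxE conjCK. Qed.

(** The complexified [A^T *m A] is Hermitian, so it is unitarily diagonalizable with real
    eigenvalues. In the eigenbasis the right side is the sum of [d 0 i] times the squared moduli of
    the coordinates of [v], and each [d 0 i] is the square of a singular value. *)
Lemma sigma_min_norm2 n (A : 'M[F]_n) (v : 'cV[C]_n) :
  sigma_min A ^+ 2 * norm2 v <= norm2 (toC A *m v).
Proof.
pose H : 'M[C]_n := toC (A^T *m A).
have Hherm : H \is hermsymmx.
  apply/is_hermitianmxP; rewrite expr0 scale1r.
  by rewrite conj_trmx_toC trmx_mul trmxK.
have HE := orthomx_spectralP (hermitian_normalmx Hherm).
set P := spectralmx H in HE; set d := spectral_diag H in HE.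
have Pu : P \is unitarymx := spectral_unitarymx H.
have dreal := hermitian_spectral_diag_real Hherm.
rewrite (invmx_unitary Pu) in HE.
have d_ge i : (sigma_min A ^+ 2)%:C <= d 0 i.
  have dE : d 0 i = (complex.Re (d 0 i))%:C by rewrite RRe_real // (mxOverP dreal).
  set r := complex.Re (d 0 i) in dE.
  have PH : P *m H = diag_mx d *m P.
    by rewrite {1}HE !mulmxA (unitarymxP Pu) mul1mx.
  pose w := row i P.
  have wH : w *m H = d 0 i *: w.
    by rewrite -row_mul PH; apply/rowP => j; rewrite mul_diag_mx !mxE.
  have w0 : w != 0.
    have := row_unitarymxP Pu i i; rewrite eqxx => h.
    by apply/eqP => w0; move: h; rewrite -/w w0 linear0l => /eqP; rewrite eq_sym oner_eq0.
  pose u : 'cV[C]_n := map_mx Num.conj w^T.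
  have uE : map_mx Num.conj u^T = w by rewrite conj_trmxK.
  have u0 : 0 < norm2 u.
    rewrite lt_neqAle norm2_ge0 andbT eq_sym norm2_eq0.
    apply: contra w0 => /eqP u0; rewrite -uE u0.
    by apply/eqP/matrixP => a b; rewrite !mxE conjC0.
  (* The Rayleigh quotient at an eigenvector shows that the eigenvalue is nonnegative, so it has a
     real square root. *)
  have Eu : norm2 (toC A *m u) = r * norm2 u.
    apply: (@complexI F); rewrite norm2_toC_mulmx uE wH -scalemxAl mxE.
    by rewrite dE rmorphM /= norm2_dot uE.
  have r0 : 0 <= r by rewrite -(pmulr_lge0 _ u0) -Eu norm2_ge0.
  have rE : r = Num.sqrt r ^+ 2 by rewrite sqr_sqrtr.
  rewrite dE lerC {}rE ler_sqr ?nnegrE ?sqrtr_ge0 ?sigma_min_ge0 //.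
  apply: sigma_min_le; split; first exact: sqrtr_ge0.
  (* The eigenvector is complex, but [singular_value] asks for a real one; the characteristic
     polynomial carries the real eigenvalue from [F[i]] back to [F]. *)
  rewrite sqr_sqrtr // eigenvalue_root_char -(fmorph_root (real_complex F)).
  rewrite map_char_poly -eigenvalue_root_char; apply/eigenvalueP; exists w => //.
  by move: wH; rewrite dE.
rewrite -lerC norm2_toC_mulmx -/H HE.
set y := P *m v.
have yE : map_mx Num.conj v^T *m map_mx Num.conj P^T = map_mx Num.conj y^T.
  by rewrite -map_mxM -trmx_mul.
have nyE : norm2 y = norm2 v.
  apply: (@complexI F); rewrite [LHS]norm2_dot [RHS]norm2_dot -yE -mulmxA (mulmxA _ P).
  by rewrite -(invmx_unitary Pu) mulVmx ?unitarymx_unit // mul1mx.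
rewrite !mulmxA yE -nyE rmorphM /= norm2E -mulmxA -/y -mulmxA mul_diag_mx mxE mulr_sumr.
apply: ler_sum => i _; rewrite !mxE.
by rewrite [leRHS]mulrCA [_^* * _]mulrC -normCK ler_wpM2r ?exprn_ge0 ?d_ge.
Qed.
End LinAlg.

(** * Determinants, roots and the chordal metric *)

Section Roots.
Local Open Scope complex_scope.
Variable F : realType.
Local Notation C := F[i].
Local Notation nc := (@Normc.normc F).

Lemma horner_char_poly (R : comNzRingType) n (A : 'M[R]_n) x :
  (char_poly A).[x] = \det (x%:M - A).
Proof.
rewrite /char_poly -horner_evalE -det_map_mx; congr (\det _).
apply/matrixP => i j; rewrite !mxE /= horner_evalE hornerD hornerN hornerC.
by rewrite hornerMn hornerX.
Qed.

Lemma det0_colP (n : nat) (A : 'M[C]_n) :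
  reflect (exists2 v : 'cV[C]_n, v != 0 & A *m v = 0) (\det A == 0).
Proof.
rewrite -det_tr; apply: (iffP det0P) => -[v v0 h].
  exists v^T; first by rewrite trmx_eq0.
  by apply: trmx_inj; rewrite trmx_mul trmxK h trmx0.
exists v^T; first by rewrite trmx_eq0.
by rewrite -trmx_mul h trmx0.
Qed.

(** The determinant is, up to sign, the product of the roots of the characteristic polynomial, and
    testing the hypothesis on an eigenvector bounds the squared modulus of each root below by
    [s]. *)
Lemma normc_det_ge n (A : 'M[C]_n) (s : F) : 0 <= s ->
  (forall v, s * norm2 v <= norm2 (A *m v)) -> s ^+ n <= nc (\det A) ^+ 2.
Proof.
move=> s0 h.
have [z zE] := closed_field_poly_normal (char_poly A).
rewrite (monicP (char_poly_monic A)) scale1r in zE.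
have sz : size z = n.
  by have := size_char_poly A; rewrite zE size_prod_XsubC => -[].
have -> : nc (\det A) = \prod_(x <- z) nc x.
  have : nc (char_poly A)`_0 = nc (\det A).
    rewrite char_poly_det Normc.normcM.
    suff -> : nc ((-1) ^+ n) = 1 by rewrite mul1r.
    elim: n {A h z zE sz} => [|n IH]; first exact: Normc.normc1.
    by rewrite exprS Normc.normcM IH normcN Normc.normc1 mulr1.
  move=> <-; rewrite zE -horner_coef0 horner_prod normc_prod.
  by apply: eq_bigr => x _; rewrite hornerXsubC sub0r normcN.
have {}zE x : x \in z -> s <= nc x ^+ 2.
  move=> xz; have : root (char_poly A) x by rewrite zE root_prod_XsubC.
  rewrite /root horner_char_poly => /det0_colP [v v0].
  rewrite mulmxBl mul_scalar_mx => /eqP; rewrite subr_eq0 => /eqP vE.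
  have := h v; rewrite -vE norm2Z ler_pM2r //.
  by rewrite lt_neqAle norm2_ge0 eq_sym norm2_eq0 v0.
rewrite -sz -prodrXl.
elim: z zE {sz} => [|x z IH] hz; first by rewrite big_nil expr0.
rewrite big_cons /= exprS ler_pM ?exprn_ge0 //; first by apply: hz; rewrite mem_head.
by apply: IH => y yz; apply: hz; rewrite inE yz orbT.
Qed.

(** Exchange one factor at a time. As [1 <= B], the spare power of [B] is harmless. *)
Lemma prod_lipschitz I (r : seq I) (a b : I -> C) (B e : F) : 1 <= B -> 0 <= e ->
  (forall i, nc (a i) <= B) -> (forall i, nc (b i) <= B) ->
  (forall i, nc (a i - b i) <= e) ->
  nc (\prod_(i <- r) a i - \prod_(i <- r) b i) <= (size r)%:R * B ^+ size r * e.
Proof.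
move=> B1 e0 ha hb hab; have B0 : 0 <= B by apply: le_trans B1.
elim: r => [|i r IH]; first by rewrite !big_nil subrr Normc.normc0 !mul0r.
rewrite !big_cons /=.
have -> : a i * \prod_(j <- r) a j - b i * \prod_(j <- r) b j =
  a i * (\prod_(j <- r) a j - \prod_(j <- r) b j) + (a i - b i) * \prod_(j <- r) b j.
  ring.
apply: le_trans (le_normcD _ _) _; rewrite !Normc.normcM.
have hB : nc (\prod_(j <- r) b j) <= B ^+ size r.
  rewrite normc_prod; elim: r {IH} => [|j r IH]; first by rewrite big_nil.
  by rewrite big_cons /= exprS ler_pM ?normc_ge0 // prodr_ge0 // => k _; rewrite normc_ge0.
have h1 : nc (a i) * nc (\prod_(j <- r) a j - \prod_(j <- r) b j) <=
    B * ((size r)%:R * B ^+ size r * e) by rewrite ler_pM ?normc_ge0.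
have h2 : nc (a i - b i) * nc (\prod_(j <- r) b j) <= e * B ^+ size r.
  by rewrite ler_pM ?normc_ge0.
have h3 : e * B ^+ size r <= e * B ^+ (size r).+1.
  by rewrite ler_wpM2l // exprS ler_peMl // exprn_ge0.
apply: le_trans (lerD h1 (le_trans h2 h3)) _.
by rewrite -natr1 exprS le_eqVlt; apply/orP; left; apply/eqP; ring.
Qed.

Lemma det_lipschitz n (A A' : 'M[C]_n) (B e : F) : 1 <= B -> 0 <= e ->
  (forall i j, nc (A i j) <= B) -> (forall i j, nc (A' i j) <= B) ->
  (forall i j, nc (A i j - A' i j) <= e) ->
  nc (\det A - \det A') <= #|{: 'S_n}|%:R * (n%:R * B ^+ n * e).
Proof.
move=> B1 e0 hA hA' hAA'; rewrite /determinant -sumrB.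
apply: le_trans (normc_sum _ _ _) _.
rewrite -sum1_card natr_sum mulr_suml; apply: ler_sum => s _.
rewrite mul1r -mulrBr Normc.normcM.
have -> : nc ((-1) ^+ s) = 1.
  by case: (odd_perm s); rewrite ?expr1 ?normcN Normc.normc1.
rewrite mul1r.
have := @prod_lipschitz _ (index_enum 'I_n) (fun i => A i (s i)) (fun i => A' i (s i)) B e B1 e0.
have -> : size (index_enum 'I_n) = n by rewrite [index_enum _]unlock -enumT size_enum_ord.
by apply.
Qed.

(** The modulus of [p.[x]] is the product of the distances from [x] to the [n] roots; if all were at
    least [eta], it would be at least [eta ^+ n]. *)
Lemma monic_root_near (p : {poly C}) n (x : C) (eta : F) : p \is monic ->
  size p = n.+1 -> 0 < eta -> nc p.[x] < eta ^+ n ->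
  exists2 y, root p y & nc (x - y) < eta.
Proof.
move=> pm sp eta0 h; have [z zE] := closed_field_poly_normal p.
rewrite (monicP pm) scale1r in zE.
have [/hasP [y yz yx]|/hasPn far] := boolP (has (fun y => nc (x - y) < eta) z).
  by exists y => //; rewrite zE root_prod_XsubC.
have sz : size z = n by move: sp; rewrite zE size_prod_XsubC => -[].
move: h; rewrite ltNge => /negP []; rewrite zE horner_prod normc_prod -sz.
elim: z far {zE sz} => [|y z IH] far; first by rewrite big_nil.
rewrite big_cons /= exprS ler_pM ?exprn_ge0 // ?(ltW eta0) //.
  by rewrite hornerXsubC leNgt far // mem_head.
by apply: IH => w wz; apply: far; rewrite inE wz orbT.
Qed.

(** Continuity of roots as a finite induction: cut the unit interval into steps so short that a root
    at one node has a root within [eta] at the next, and hand [good] over. The Lipschitz bound is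
    asked only at roots, since these stay in a bounded region while [q] is unbounded in [x]. *)
Lemma root_tracking (q : F -> C -> C) (good : C -> Prop) (n : nat) (c L eta : F) :
  0 < c -> 0 < eta ->
  (forall t : F, 0 <= t <= 1 -> exists p : {poly C}, [/\ p \is monic, size p = n.+1 &
     exists2 k, c <= nc k & forall x, q t x = k * p.[x]]) ->
  (forall (t t' : F) x, 0 <= t <= 1 -> 0 <= t' <= 1 -> q t x = 0 ->
     nc (q t' x) <= L * `|t - t'|) ->
  (forall (t t' : F) x y, 0 <= t <= 1 -> 0 <= t' <= 1 -> q t x = 0 -> q t' y = 0 ->
     nc (x - y) < eta -> good x -> good y) ->
  (exists2 x, q 0 x = 0 & good x) -> exists2 x, q 1 x = 0 & good x.
Proof.
move=> c0 eta0 hp hL hgood h0.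
(* With this many steps, [q] at the next node is below [c * eta ^+ n] at the old root, hence its
   monic factor is below [eta ^+ n]. *)
set m := (Num.truncn (L / (c * eta ^+ n))).+1.
have m0 : 0 < m%:R :> F by rewrite ltr0n.
have ce : 0 < c * eta ^+ n by rewrite mulr_gt0 ?exprn_gt0.
have hm : L / m%:R < c * eta ^+ n.
  by rewrite ltr_pdivrMr // mulrC -ltr_pdivrMr // truncnS_gt.
have tP k : (k <= m)%N -> 0 <= (k%:R / m%:R : F) <= 1.
  by move=> km; rewrite divr_ge0 //= ler_pdivrMr // mul1r ler_nat.
suff h k : (k <= m)%N -> exists2 x, q (k%:R / m%:R) x = 0 & good x.
  by have := h m (leqnn _); rewrite divff ?gt_eqF.
elim: k => [|k IH] km; first by rewrite mul0r.
have [x qx gx] := IH (ltnW km).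
have [p [pm sp [a ca qE]]] := hp _ (tP _ km).
have := hL _ _ x (tP _ (ltnW km)) (tP _ km) qx.
have -> : `|k%:R / m%:R - k.+1%:R / m%:R| = m%:R^-1 :> F.
  rewrite -mulrBl -natr1 opprD addrA subrr sub0r mulN1r normrN.
  by rewrite ger0_norm // invr_ge0 ltW.
move=> /le_lt_trans/(_ hm); rewrite qE Normc.normcM => h.
have hx : nc p.[x] < eta ^+ n.
  rewrite -(ltr_pM2l c0); apply: le_lt_trans h.
  by rewrite ler_wpM2r ?normc_ge0.
have [y /rootP py xy] := monic_root_near pm sp eta0 hx.
have qy : q (k.+1%:R / m%:R) y = 0 by rewrite qE py mulr0.
by exists y => //; exact: hgood (tP _ (ltnW km)) (tP _ km) qx qy xy gx.
Qed.

Definition sphere_scale (x : C) : F := Num.sqrt (1 + nc x ^+ 2).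

(** The chordal distance on the Riemann sphere of diameter 1; equivalently the sine of the angle
    between the complex lines through [(1, x)] and [(1, y)]. *)
Definition chord (x y : C) : F := nc (x - y) / (sphere_scale x * sphere_scale y).

Lemma sphere_scale_ge1 x : 1 <= sphere_scale x.
Proof. by rewrite -[leLHS]sqrtr1 ler_wsqrtr // lerDl sqr_ge0. Qed.

Lemma sphere_scale_gt0 x : 0 < sphere_scale x.
Proof. exact: lt_le_trans (sphere_scale_ge1 x). Qed.

Lemma sqr_sphere_scale x : sphere_scale x ^+ 2 = 1 + nc x ^+ 2.
Proof. by rewrite sqr_sqrtr // addr_ge0 ?sqr_ge0. Qed.

Lemma chord_sym x y : chord x y = chord y x.
Proof. by rewrite /chord -normcN opprB [X in _ / X]mulrC. Qed.

Lemma chord_le x y : chord x y <= nc (x - y).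
Proof.
rewrite ler_pdivrMr ?mulr_gt0 ?sphere_scale_gt0 // ler_peMr ?normc_ge0 //.
by rewrite -[1]mulr1 ler_pM ?sphere_scale_ge1.
Qed.

Lemma chord_triangle z x y : chord x y <= chord x z + chord z y.
Proof.
have h (u v : C) : nc (1 + u^*%C * v) <= sphere_scale u * sphere_scale v.
  rewrite -ler_sqr ?nnegrE ?normc_ge0 ?mulr_ge0 ?(ltW (sphere_scale_gt0 _)) //.
  rewrite exprMn !sqr_sphere_scale; case: u v => a b [c d]; rewrite !sqr_normcE.
  by have := sqr_ge0 (a - c); have := sqr_ge0 (b - d); nra.
have wE (u : C) : (1 + u * u^*%C) = (sphere_scale u ^+ 2)%:C.
  rewrite sqr_sphere_scale; case: u => a b; rewrite sqr_normcE.
  by apply/eqP; rewrite eq_complex /=; apply/andP; split; apply/eqP; ring.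
(* This identity splits the numerator; Cauchy-Schwarz for [(1, u)] and [(1, v)], which is [h],
   bounds the two cofactors. *)
have E : (x - y) * (sphere_scale z ^+ 2)%:C =
   (x - z) * (1 + z^*%C * y) + (z - y) * (1 + z^*%C * x) by rewrite -wE; ring.
have {}E : nc (x - y) * sphere_scale z ^+ 2 <=
    nc (x - z) * (sphere_scale z * sphere_scale y) +
    nc (z - y) * (sphere_scale z * sphere_scale x).
  rewrite -[sphere_scale z ^+ 2]ger0_norm ?sqr_ge0 // -normc_real -Normc.normcM E.
  apply: le_trans (le_normcD _ _) _.
  by rewrite !Normc.normcM lerD // ler_wpM2l ?normc_ge0.
have [x0 y0 z0] := And3 (sphere_scale_gt0 x) (sphere_scale_gt0 y) (sphere_scale_gt0 z).
rewrite /chord.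
have -> : nc (x - z) / (sphere_scale x * sphere_scale z) +
  nc (z - y) / (sphere_scale z * sphere_scale y) =
  (nc (x - z) * (sphere_scale z * sphere_scale y) +
    nc (z - y) * (sphere_scale z * sphere_scale x)) / sphere_scale z ^+ 2 /
   (sphere_scale x * sphere_scale y) by field; rewrite !gt_eqF.
by rewrite ler_pM2r ?invr_gt0 ?mulr_gt0 // ler_pdivlMr ?exprn_gt0.
Qed.

End Roots.

(** * Angles and clusters of lines *)

Section Angles.
Local Open Scope complex_scope.
Variable F : realType.
Local Notation C := F[i].
Local Notation nc := (@Normc.normc F).

Definition det2 (lam mu : 'cV[F]_2) : F := lam 0 0 * mu 1 0 - lam 1 0 * mu 0 0.

Lemma euclid_norm_eq1 (lam : 'cV[F]_2) :
  euclid_norm lam = 1 -> lam 0 0 ^+ 2 + lam 1 0 ^+ 2 = 1.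
Proof.
rewrite /euclid_norm big_ord_recl big_ord1 => h.
have -> : (1 : 'I_2) = lift ord0 ord0 by apply: val_inj.
by rewrite -[LHS]sqr_sqrtr ?h ?expr1n // addr_ge0 ?sqr_ge0.
Qed.

Lemma chi_unit (lam mu : 'cV[F]_2) : euclid_norm lam = 1 -> euclid_norm mu = 1 ->
  chi lam mu = `|det2 lam mu|.
Proof.
move=> l1 m1; rewrite /chi l1 m1 mulr1 divr1.
move: (euclid_norm_eq1 l1) (euclid_norm_eq1 m1); rewrite big_ord_recl big_ord1.
have <- : (1 : 'I_2) = lift ord0 ord0 by apply: val_inj.
rewrite -/(0 : 'I_2) /det2.
move: (lam 0 0) (lam 1 0) (mu 0 0) (mu 1 0) => a b c d ab cd.
have E : (a * c + b * d) ^+ 2 + (a * d - b * c) ^+ 2 = 1.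
  rewrite -[RHS]mulr1 -{1}ab -cd; ring.
have le1 : `|a * c + b * d| <= 1.
  rewrite -[leRHS]normr1 -ler_sqr ?nnegrE ?normr_ge0 // !real_normK ?num_real // expr1n.
  by rewrite -E lerDl sqr_ge0.
rewrite sin_acos; last by rewrite le1 andbT; apply: le_trans (normr_ge0 _); rewrite oppr_le0.
by rewrite real_normK ?num_real // -E addrC addKr sqrtr_sqr.
Qed.

(** [theta] is a choice with default 0, so an angle has to be exhibited before anything is known
    about it. *)
Lemma theta_unit (lam : 'cV[F]_2) : euclid_norm lam = 1 ->
  0 <= theta lam < pi /\
  exists2 e, e ^+ 2 = 1 & lam = e *: unit_direction (theta lam).
Proof.
move=> l1; have ab := euclid_norm_eq1 l1.
have span (v w : 'cV[F]_2) e : e ^+ 2 = 1 -> v = e *: w -> (<[v]> = <[w]>)%VS.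
  move=> e1 ->; have e0 : e != 0.
    by apply/eqP => e0; move/eqP: e1; rewrite e0 expr0n eq_sym oner_eq0.
  apply/eqP; rewrite eqEsubv -!memvE; apply/andP; split; first by rewrite memvZ // memv_line.
  by apply/vlineP; exists e^-1; rewrite scalerA mulVf // scale1r.
have l0 : lam != 0.
  apply/eqP => l0; move: ab; rewrite l0 !mxE expr0n addr0 => /eqP.
  by rewrite eq_sym oner_eq0.
have ex : exists t : F, 0 <= t < pi /\ (<[lam]> = <[unit_direction t]>)%VS.
  pose a := lam 0 0; pose b := lam 1 0.
  have aux (c d : F) : c ^+ 2 + d ^+ 2 = 1 -> 0 <= d -> c != -1 ->
      [/\ 0 <= acos c < pi, cos (acos c) = c & sin (acos c) = d].
    move=> cd d0 cN1.
    have c1 : -1 <= c <= 1 by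
      rewrite -ler_norml -[leRHS]normr1 -ler_sqr ?nnegrE ?normr_ge0 // !real_normK ?num_real // expr1n -cd lerDl sqr_ge0.
    split.
    - rewrite acos_ge0 //= acos_ltpi //; case/andP: c1 => c1 ->; rewrite andbT.
      by rewrite lt_neqAle eq_sym cN1.
    - by rewrite acosK // in_itv.
    - by rewrite sin_acos // -cd addrC addKr sqrtr_sqr ger0_norm.
  have ext t e : e ^+ 2 = 1 -> a = e * cos t -> b = e * sin t ->
      (<[lam]> = <[unit_direction t]>)%VS.
    move=> e1 ha hb; apply: span e1 _; apply/colP => i; rewrite !mxE.
    case: i => -[|[|//]] p /=.
      by rewrite -ha; congr (lam _ _); apply: val_inj.
    by rewrite -hb; congr (lam _ _); apply: val_inj.
  (* Of the two unit vectors [lam] and [- lam], take the one in the upper half plane or on the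
     positive axis; its angle is the [acos] of its first coordinate. The point -1 is excluded
     because there [acos] equals [pi]. *)
  have [b0|b0] := boolP ((0 < b) || ((b == 0) && (0 < a))).
    have [||t1 t2 t3] := aux a b ab.
    - by case/orP: b0 => [/ltW//|/andP[/eqP-> _]].
    - apply/eqP => aN;
      move: b0 ab; rewrite -/a -/b aN => /orP[b0|/andP[_]]; last by rewrite oppr_gt0 ltNge ler01.
      by move=> h; nra.
    by exists (acos a); split=> //; apply: (@ext _ 1); rewrite ?expr1n ?mul1r ?t2 ?t3.
  move: b0; rewrite negb_or negb_and -!leNgt => /andP[b0 b0'].
  have [|||t1 t2 t3] := aux (- a) (- b).
  - by rewrite !sqrrN.
  - by rewrite oppr_ge0.
  - rewrite eqr_oppLR opprK; apply/eqP => a1;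
    move: b0' ab; rewrite -/a -/b a1 orbC leNgt ltr01 /= => b1.
    move=> h; have /eqP : b ^+ 2 = 0 by lra.
    by rewrite sqrf_eq0 (negbTE b1).
  exists (acos (- a)); split=> //; apply: (@ext _ (- 1));
    rewrite ?sqrrN ?expr1n ?mulN1r ?t2 ?t3 ?opprK //.
have [tp hs] := xgetPex 0 ex.
rewrite -/(theta lam) in tp hs; split=> //.
have /vlineP [e le] : lam \in (<[unit_direction (theta lam)]>)%VS by rewrite -hs memv_line.
exists e => //; move: ab; rewrite {1 2}le !mxE /= !exprMn -mulrDr cos2Dsin2 mulr1.
by [].
Qed.

Lemma det2_sin (lam mu : 'cV[F]_2) : euclid_norm lam = 1 -> euclid_norm mu = 1 ->
  `|det2 lam mu| = `|sin (theta mu - theta lam)|.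
Proof.
move=> /theta_unit[_ [e e1 le]] /theta_unit[_ [f f1 mf]].
have -> : det2 lam mu = e * f * sin (theta mu - theta lam).
  rewrite {1}le {1}mf /det2 !mxE /= sinB; ring.
rewrite normrM; suff -> : `|e * f| = 1 by rewrite mul1r.
by apply/eqP; rewrite -sqr_norm_eq1 exprMn e1 f1 mulr1.
Qed.

(** On a subinterval of [[0, pi]] the sine is smallest at an endpoint: it increases up to [pi / 2]
    and is symmetric about it. *)
Lemma sin_between (a t b m : F) : 0 <= a -> a <= t -> t <= b -> b <= pi ->
  m <= sin a -> m <= sin b -> m <= sin t.
Proof.
have incr (x y : F) : 0 <= x -> x <= y -> y <= pi / 2 -> sin x <= sin y.
  move=> x0 xy yp; rewrite leNgt ltr_sin ?in_itv /= -?leNgt //; apply/andP; split; lra.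
move=> a0 at' tb bp ha hb; have [tp|tp] := leP t (pi / 2).
  by apply: le_trans ha _; apply: incr.
have sp (x : F) : sin x = sin (pi - x) by rewrite sinB sinpi cospi; ring.
apply: le_trans hb _; rewrite sp [leRHS]sp; apply: incr; lra.
Qed.

(* The square of a - ib does not depend on the sign of the unit vector (a, b). *)
Definition circle_pt (lam : 'cV[F]_2) : C := (lam 0 0 -i* lam 1 0) ^+ 2.

Lemma normc_unit (lam : 'cV[F]_2) : euclid_norm lam = 1 ->
  nc (lam 0 0 -i* lam 1 0) = 1.
Proof. by move=> /euclid_norm_eq1 h; rewrite /Normc.normc sqrrN h sqrtr1. Qed.

Lemma normc_circle_pt (lam : 'cV[F]_2) : euclid_norm lam = 1 ->
  nc (circle_pt lam) = 1.
Proof. by move=> h; rewrite /circle_pt expr2 Normc.normcM normc_unit ?mulr1. Qed.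

(** [circle_pt] doubles angles (and reverses them), and on the unit circle the chordal distance is
    half the Euclidean one; half of the distance between points at angle [2 t] is [sin t] in
    absolute value. *)
Lemma chord_circle_pt (lam mu : 'cV[F]_2) : euclid_norm lam = 1 ->
  euclid_norm mu = 1 -> chord (circle_pt lam) (circle_pt mu) = `|det2 lam mu|.
Proof.
move=> l1 m1.
rewrite /chord /sphere_scale !normc_circle_pt // expr1n -expr2 sqr_sqrtr; last by lra.
suff -> : nc (circle_pt lam - circle_pt mu) = 2 * `|det2 lam mu| by field.
apply/eqP; rewrite -(@eqrXn2 _ 2) ?normc_ge0 ?mulr_ge0 // exprMn real_normK ?num_real //.
have := euclid_norm_eq1 l1; have := euclid_norm_eq1 m1.
rewrite /circle_pt /det2; move: (lam 0 0) (lam 1 0) (mu 0 0) (mu 1 0) => a b c d cd ab.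
rewrite !expr2 -[_ - _]/((a * a - (- b) * (- b) - (c * c - (- d) * (- d))) +i*
  (a * - b + - b * a - (c * - d + - d * c))) -!expr2 sqr_normcE.
apply/eqP; transitivity ((a ^+ 2 + b ^+ 2) ^+ 2 + (c ^+ 2 + d ^+ 2) ^+ 2 -
  2 * (a * c + b * d) ^+ 2 + 2 * (a * d - b * c) ^+ 2).
  ring.
have -> : (a * c + b * d) ^+ 2 =
  (a ^+ 2 + b ^+ 2) * (c ^+ 2 + d ^+ 2) - (a * d - b * c) ^+ 2 by ring.
by rewrite ab cd; ring.
Qed.

Lemma nth_largest_count (J : nat) (h : seq F) : (1 <= J <= size h)%N ->
  (J <= count (fun x => (nth_largest J h <= x)%R) h)%N.
Proof.
move=> /andP[J0 Jh]; rewrite /nth_largest.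
set s := sort _ h; set x := nth 0 s J.-1.
have ss : sorted (fun a b : F => b <= a) s.
  by apply: sort_sorted => a b; exact: le_total.
rewrite -(seq.permP (permEl (perm_sort (fun a b : F => b <= a) h))) -/s.
rewrite -{1}(cat_take_drop J s) count_cat.
have sJ : size (take J s) = J by rewrite size_takel // size_sort.
suff : all (fun y => x <= y) (take J s).
  by rewrite all_count sJ => /eqP ->; rewrite leq_addr.
apply/(all_nthP 0) => i; rewrite sJ => iJ; rewrite nth_take //.
apply: (sorted_leq_nth _ _ 0 ss); rewrite ?inE ?size_sort //.
- by move=> a b c /= ba cb; exact: le_trans ba.
- exact: leq_trans iJ Jh.
- by rewrite prednK.
- by rewrite -ltnS prednK.
Qed.

Lemma count_iota_lt (p : pred nat) i j :
  (count p (iota 0 i) < count p (iota 0 j))%N ->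
  exists2 k, (i <= k < j)%N & p k.
Proof.
move=> h; have ij : (i <= j)%N.
  rewrite leqNgt; apply: contraL h => /ltnW ji; rewrite -leqNgt.
  by rewrite -(subnKC ji) iotaD count_cat leq_addr.
move: h; rewrite -{1}(subnKC ij) iotaD count_cat -[X in (X < _)%N]addn0 ltn_add2l add0n -has_count.
by move=> /hasP [k]; rewrite mem_iota subnKC // => *; exists k.
Qed.

Section Clusters.
Variables (s : seq 'cV[F]_2) (D : F).
Hypothesis s_unit : forall lam, lam \in s -> euclid_norm lam = 1.
Hypothesis s_sorted : sorted (fun lam mu => theta lam <= theta mu) s.
Local Notation v := (nth 0 s).

(** The modulus makes the first line the successor of the last. [D] will be twice the [J]-th largest
    half gap. *)
Definition big_gap (i : nat) : bool := D <= chi (v i) (v (i.+1 %% size s)).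

(* The index of the arc between consecutive big gaps that contains the i-th line;
   the modulus glues the last arc to the first one. *)
Definition cluster (i : nat) : nat :=
  count big_gap (iota 0 i) %% count big_gap (iota 0 (size s)).

Lemma theta_nth_le i j : (i <= j)%N -> (j < size s)%N -> theta (v i) <= theta (v j).
Proof.
move=> ij js; apply: (sorted_leq_nth _ _ 0 s_sorted) => //.
- by move=> a b c /=; exact: le_trans.
- by rewrite inE (leq_ltn_trans ij).
Qed.

Lemma big_gap_sin i : (i.+1 < size s)%N -> big_gap i ->
  D <= sin (theta (v i.+1) - theta (v i)).
Proof.
move=> iz; have iz' := ltnW iz.
have u1 := s_unit (mem_nth 0 iz); have u0 := s_unit (mem_nth 0 iz').
rewrite /big_gap modn_small // chi_unit // det2_sin // ger0_norm // sin_ge0_pi //.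
have := theta_nth_le (leqnSn i) iz.
have [/andP[? ?] _] := theta_unit u1; have [/andP[? ?] _] := theta_unit u0.
move=> ?; apply/andP; split; lra.
Qed.

(** The gap that closes the circle has angle [pi] minus the difference below, hence the same
    sine. *)
Lemma big_gap_last i : i.+1 = size s -> big_gap i ->
  D <= sin (theta (v i) - theta (v 0%N)).
Proof.
move=> iz; have iz' : (i < size s)%N by rewrite -iz.
have s0 : (0 < size s)%N by rewrite -iz.
have u1 := s_unit (mem_nth 0 iz'); have u0 := s_unit (mem_nth 0 s0).
rewrite /big_gap iz modnn chi_unit // det2_sin // -opprB sinN normrN.
rewrite ger0_norm // sin_ge0_pi //.
have := theta_nth_le (leq0n i) iz'.
have [/andP[? ?] _] := theta_unit u1; have [/andP[? ?] _] := theta_unit u0.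
move=> ?; apply/andP; split; lra.
Qed.

Lemma det2_sym (lam mu : 'cV[F]_2) : `|det2 lam mu| = `|det2 mu lam|.
Proof. by rewrite -normrN /det2 opprB mulrC [X in _ - X]mulrC. Qed.

(** Two lines in different clusters have a big gap between them on either way around. The inner gap
    bounds the angle difference below, the outer one bounds it above by [pi] minus a gap, and
    [sin_between] concludes. *)
Lemma cluster_separated i j : (i < size s)%N -> (j < size s)%N ->
  cluster i != cluster j -> D <= `|det2 (v i) (v j)|.
Proof.
wlog ij : i j / (i < j)%N.
  move=> H; case: (ltngtP i j) => [|ji iz js|-> _ _]; first exact: H.
    by rewrite eq_sym det2_sym; exact: H.
  by rewrite eqxx.
move=> iz js cij.
have ui := s_unit (mem_nth 0 iz); have uj := s_unit (mem_nth 0 js).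
have thij := theta_nth_le (ltnW ij) js.
have [/andP[ti0 tip] _] := theta_unit ui; have [/andP[tj0 tjp] _] := theta_unit uj.
have le_count k l : (k <= l)%N -> (count big_gap (iota 0 k) <= count big_gap (iota 0 l))%N.
  by move=> kl; rewrite -(subnKC kl) iotaD count_cat leq_addr.
have [k /andP[ik kj] bk] : exists2 k, (i <= k < j)%N & big_gap k.
  apply: count_iota_lt; rewrite ltn_neqAle le_count ?(ltnW ij) // andbT.
  by apply: contra cij => /eqP e; rewrite /cluster e.
rewrite det2_sin // ger0_norm; last first.
  by rewrite sin_ge0_pi //; apply/andP; split; lra.
have ks : (k.+1 < size s)%N by apply: leq_ltn_trans js.
have hk := big_gap_sin ks bk.
have t1 := theta_nth_le ik (ltnW ks); have t2 := theta_nth_le kj js.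
have t3 := theta_nth_le (leqnSn k) ks.
have sp (x : F) : sin (pi - x) = sin x by rewrite sinB sinpi cospi; ring.
have around l : (l.+1 < size s)%N -> big_gap l -> (j <= l)%N || (l < i)%N ->
    D <= sin (theta (v j) - theta (v i)).
  move=> ls bl jl; have hl := big_gap_sin ls bl.
  have t4 := theta_nth_le (leqnSn l) ls.
  have [/andP[? ?] _] := theta_unit (s_unit (mem_nth 0 ls)).
  have [/andP[? ?] _] := theta_unit (s_unit (mem_nth 0 (ltnW ls))).
  apply: (sin_between _ _ _ _ hk (b := pi - (theta (v l.+1) - theta (v l)))).
  - lra.
  - lra.
  - case/orP: jl => [jl|li].
      have := theta_nth_le jl (ltnW ls); lra.
    have := theta_nth_le li iz; lra.
  - lra.
  - by rewrite sp.
(* If no big gap follows [j], then [j] lies in the glued cluster 0; since [i] does not, some big gap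
   precedes [i]. *)
have [cj|cj] := eqVneq (count big_gap (iota 0 j)) (count big_gap (iota 0 (size s))).
  have [l /andP[_ li] bl] : exists2 l, (0 <= l < i)%N & big_gap l.
    apply: count_iota_lt; rewrite /= lt0n; apply: contra cij => /eqP e.
    by rewrite /cluster e cj modnn mod0n.
  by apply: (around l) => //; [apply: leq_ltn_trans iz | rewrite li orbT].
have [l /andP[jl ls] bl] : exists2 l, (j <= l < size s)%N & big_gap l.
  by apply: count_iota_lt; rewrite ltn_neqAle cj le_count // ltnW.
have [ls'|] := ltnP l.+1 (size s); first by apply: (around l) => //; rewrite jl.
(* The outer gap is the closing one, so the upper end of the interval is the angle from the first
   line to the last. *)
move=> ls'; have {ls'}le : l.+1 = size s by apply/eqP; rewrite eqn_leq ls.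
have hl := big_gap_last le bl.
have t4 := theta_nth_le (leq0n i) iz; have t5 := theta_nth_le jl ls.
have s0 : (0 < size s)%N by apply: leq_ltn_trans iz.
have [/andP[? ?] _] := theta_unit (s_unit (mem_nth 0 s0)).
have [/andP[? ?] _] := theta_unit (s_unit (mem_nth 0 ls)).
by apply: (sin_between _ _ _ _ hk hl); lra.
Qed.

(** The line just before a big gap is the last of its arc, so such lines have different counts, all
    below the total; the modulus does not change them. Hence there are as many clusters as big
    gaps. *)
Lemma cluster_big_gap_inj :
  {in filter big_gap (iota 0 (size s)) &, injective cluster}.
Proof.
have h i : i \in filter big_gap (iota 0 (size s)) ->
    cluster i = count big_gap (iota 0 i) /\
    forall j, (i < j)%N -> (count big_gap (iota 0 i) < count big_gap (iota 0 j))%N.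
  rewrite mem_filter mem_iota add0n => /andP[bi /andP[_ iz]].
  have lt j : (i < j)%N -> (count big_gap (iota 0 i) < count big_gap (iota 0 j))%N.
    move=> ij; rewrite -(subnKC ij) iotaD count_cat
      -[in iota 0 i.+1]addn1 iotaD count_cat /= add0n bi.
    by rewrite addn0 addn1 leq_addr.
  by split=> //; rewrite /cluster modn_small // lt.
move=> i j /h[-> hi] /h[-> hj] e; case: (ltngtP i j) => // [/hi|/hj]; by rewrite e ltnn.
Qed.

End Clusters.

Lemma half_gaps_nth n (C : 'M[F]_(2, n)) i : (i < n)%N ->
  nth 0 (half_gaps C) i =
  chi (nth 0 (sorted_columns C) i) (nth 0 (sorted_columns C) (i.+1 %% n)) / 2.
Proof.
move=> i_n; set s := sorted_columns C.
have ss : size s = n by rewrite size_sort size_map size_enum_ord.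
rewrite (nth_map (0, 0)) ?size_zip ?size_rot ?minnn ?ss //.
rewrite nth_zip ?size_rot //=; congr (chi _ _ / _).
rewrite /rot nth_cat size_drop ss nth_drop add1n ltn_subRL add1n.
case: (ltnP i.+1 n) => [h|h]; first by rewrite modn_small.
have e : i.+1 = n by apply/eqP; rewrite eqn_leq i_n.
have -> : (i - (n - 1))%N = 0%N by rewrite -e subn1 subnn.
by rewrite e modnn nth_take.
Qed.

Lemma size_half_gaps n (C : 'M[F]_(2, n)) : size (half_gaps C) = n.
Proof.
by rewrite size_map size_zip size_rot minnn size_sort size_map size_enum_ord.
Qed.

Lemma mem_sorted_columns n (C : 'M[F]_(2, n)) lam :
  lam \in sorted_columns C -> exists r, lam = col r C.
Proof. by rewrite mem_sort => /mapP [r _ ->]; exists r. Qed.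

(** Half gaps are halved sines. The bound [2^-1] is what keeps the eigenvalues away from the point
    at infinity. *)
Lemma nth_largest_half_gaps n (C : 'M[F]_(2, n)) J :
  (forall r, euclid_norm (col r C) = 1) -> (1 <= J <= n)%N ->
  0 <= nth_largest J (half_gaps C) <= 2^-1.
Proof.
move=> hC /andP[J1 Jn]; rewrite /nth_largest.
set h := sort _ _; have : nth 0 h J.-1 \in h.
  by rewrite mem_nth // size_sort size_half_gaps prednK.
rewrite mem_sort => /(nthP 0) [k]; rewrite size_half_gaps => i_n <-.
have su lam : lam \in sorted_columns C -> euclid_norm lam = 1.
  by move=> /mem_sorted_columns [r ->].
have ss : size (sorted_columns C) = n by rewrite size_sort size_map size_enum_ord.
have u m : (m < n)%N -> euclid_norm (nth 0 (sorted_columns C) m) = 1.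
  by move=> mn; apply: su; rewrite mem_nth ?ss.
rewrite half_gaps_nth //; set x := nth _ _ _; set y := nth _ _ _.
have c1 : chi x y <= 1 by exact: sin_le1.
have c0 : 0 <= chi x y.
  by rewrite chi_unit ?u // ltn_mod (leq_ltn_trans _ i_n).
by apply/andP; split; lra.
Qed.

End Angles.

(** * Pencils along the unit circle *)

Section Pencils.
Local Open Scope complex_scope.
Variable F : realType.
Local Notation C := F[i].
Local Notation nc := (@Normc.normc F).
Local Notation toC := (map_mx (real_complex F)).

Definition frob2 m n p (M : tensor F m n p) : F :=
  \sum_k \sum_i \sum_j M k i j ^+ 2.

Lemma frob2_ge0 m n p (M : tensor F m n p) : 0 <= frob2 M.
Proof. by do 3!(rewrite sumr_ge0 // => ? _); rewrite sqr_ge0. Qed.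

Variable n : nat.

Definition pencil_at (M : tensor F n n 2) (a b : C) : 'M[C]_n :=
  b *: toC (M 0) - a *: toC (M 1).

Lemma pencil_at_cpd (A B : 'M[F]_n) (D : 'M[F]_(2, n)) a b :
  pencil_at (cpd_tensor A B D) a b =
  toC A *m diag_mx (\row_r (b * (D 0 r)%:C - a * (D 1 r)%:C)) *m toC B^T.
Proof.
apply/matrixP => i j; rewrite !mxE !ffunE !mxE !rmorph_sum !mulr_sumr -sumrB.
apply: eq_bigr => r _; rewrite mul_mx_diag !mxE !rmorphM /=; ring.
Qed.

Lemma pencil_at_cpd_ge (A B : 'M[F]_n) (D : 'M[F]_(2, n)) a b m v :
  0 <= m -> (forall r, m <= nc (b * (D 0 r)%:C - a * (D 1 r)%:C) ^+ 2) ->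
  (sigma_min A * sigma_min B) ^+ 2 * m * norm2 v <=
  norm2 (pencil_at (cpd_tensor A B D) a b *m v).
Proof.
move=> m0 hm; rewrite pencil_at_cpd -!mulmxA.
apply: le_trans (sigma_min_norm2 _ _);
have -> : (sigma_min A * sigma_min B) ^+ 2 * m * norm2 v =
  sigma_min A ^+ 2 * (m * (sigma_min B ^+ 2 * norm2 v)) by ring.
rewrite ler_wpM2l ?sqr_ge0 //.
apply: le_trans (norm2_diag_ge _ (m := m) _); last by move=> r; rewrite mxE.
rewrite ler_wpM2l //.
by apply: le_trans (sigma_min_norm2 _ _); rewrite sigma_min_trmx.
Qed.

Lemma pencil_at_le (M : tensor F n n 2) a b v :
  norm2 (pencil_at M a b *m v) <= (nc a ^+ 2 + nc b ^+ 2) * frob2 M * norm2 v.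
Proof.
apply: le_trans (norm2_mulmx_le _ _) _; rewrite ler_wpM2r ?norm2_ge0 //.
rewrite /frob2 big_ord_recl big_ord1 -big_split mulr_sumr; apply: ler_sum => i _.
rewrite -big_split mulr_sumr; apply: ler_sum => j _.
have -> : lift ord0 ord0 = 1 :> 'I_2 by apply: val_inj.
rewrite !mxE; move: (M 0 i j) (M 1 i j) => x y.
case: a b => a1 a2 [b1 b2]; rewrite !sqr_normcE.
rewrite /= !(mulr0, subr0, add0r, addr0).
(* Lagrange's identity again: for real [x] and [y] the defect is the squared modulus of
   [a x + b y]. *)
rewrite -subr_ge0 [leRHS](_ : _ = (b1 * y + a1 * x) ^+ 2 + (b2 * y + a2 * x) ^+ 2).
  by rewrite addr_ge0 ?sqr_ge0.
ring.
Qed.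

Lemma pencil_at_entry_le (M : tensor F n n 2) a b (c : F) i j :
  nc a <= c -> nc b <= c ->
  nc (pencil_at M a b i j) <= c * (`|M 0 i j| + `|M 1 i j|).
Proof.
move=> ha hb; rewrite !mxE; apply: le_trans (le_normcD _ _) _.
rewrite normcN !Normc.normcM !normc_real mulrDr.
by rewrite lerD // ler_wpM2r.
Qed.

Lemma pencil_atD (M N : tensor F n n 2) a b :
  pencil_at (M + N) a b = pencil_at M a b + pencil_at N a b.
Proof. by rewrite /pencil_at !ffunE !map_mxD !scalerDr opprD addrACA. Qed.

Lemma normc_i : nc 'i%C = 1.
Proof. by rewrite /Normc.normc expr0n expr1n add0r sqrtr1. Qed.

(* The complex projective line is parametrized by x |-> (1 + x : i (x - 1));
   its real points correspond to the unit circle, so that x = infinity, i.e.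
   (1 : i), stays away from all real generalized eigenvalues. *)
Definition mu0 (x : C) : C := 1 + x.
Definition mu1 (x : C) : C := 'i%C * (x - 1).

(** Up to the factor [sqrt 2], the parametrization is a unitary change of the homogeneous
    coordinates [(1, x)], so chordal distances in [x] are distances between lines. *)
Lemma sqr_normc_mu x : nc (mu0 x) ^+ 2 + nc (mu1 x) ^+ 2 = 2 * (1 + nc x ^+ 2).
Proof.
case: x => a b; rewrite /mu0 /mu1 Normc.normcM normc_i.
have -> : 1 + (a +i* b) = (1 + a) +i* b.
  by apply/eqP; rewrite eq_complex /=; apply/andP; split; apply/eqP; ring.
have -> : (a +i* b) - 1 = (a - 1) +i* b.
  by apply/eqP; rewrite eq_complex /=; apply/andP; split; apply/eqP; ring.
rewrite mul1r !sqr_normcE; ring.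
Qed.

(** With [w = a + ib] for [lam = (a, b)], the left determinant is [i w (x - circle_pt lam)], because
    [w] has modulus 1 and inverse [a - ib]. *)
Lemma normc_pencil_at_circle (lam : 'cV[F]_2) x : euclid_norm lam = 1 ->
  nc (mu1 x * (lam 0 0)%:C - mu0 x * (lam 1 0)%:C) = nc (x - circle_pt lam).
Proof.
move=> l1; rewrite /mu0 /mu1 /circle_pt.
have ii : ('i%C : C) * 'i%C = -1 by rewrite -expr2 sqr_i.
set w := (lam 0 0)%:C + 'i%C * (lam 1 0)%:C.
set u := (lam 0 0 -i* lam 1 0 : C).
have uE : u = (lam 0 0)%:C - 'i%C * (lam 1 0)%:C.
  by apply/eqP; rewrite eq_complex /=; apply/andP; split; apply/eqP; ring.
have wu : w * u = 1.
  have -> : w * u = (lam 0 0 ^+ 2 + lam 1 0 ^+ 2)%:C.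
    rewrite uE /w rmorphD !rmorphXn /=.
    transitivity ((lam 0 0)%:C ^+ 2 - ('i%C * 'i%C) * (lam 1 0)%:C ^+ 2); first by ring.
    by rewrite ii; ring.
  by rewrite (euclid_norm_eq1 l1).
have nu : nc u = 1 by exact: normc_unit.
have nw : nc w = 1.
  by have := congr1 nc wu; rewrite Normc.normcM nu mulr1 Normc.normc1.
have -> : nc (x - u ^+ 2) = nc ('i%C * (w * (x - u ^+ 2))).
  by rewrite !Normc.normcM normc_i nw !mul1r.
congr nc.
transitivity ('i%C * (w * x - w * u * u));
  last by rewrite expr2 [w * (x - _)]mulrBr [w * (u * u)]mulrA.
rewrite wu mul1r uE /w.
transitivity ('i%C * ((lam 0 0)%:C * (x - 1)) +
  ('i%C * 'i%C) * ((lam 1 0)%:C * (x + 1))); last by ring.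
by rewrite ii; ring.
Qed.

End Pencils.

(** * Eigenvalues of perturbed pencils *)

Section Perturbation.
Local Open Scope complex_scope.
Variable F : realType.
Local Notation C := F[i].
Local Notation nc := (@Normc.normc F).
Local Notation toC := (map_mx (real_complex F)).

(** This is the shape that [root_tracking] asks for: a constant times a monic polynomial of degree
    [n]. Here [N] will be the pencil at [(1 : i)], the coefficient of [x]. *)
Lemma det_affine n (H N : 'M[C]_n) x : N \in unitmx ->
  \det (H + x *: N) = \det N * (char_poly (- (invmx N *m H))).[x].
Proof.
move=> uN; rewrite horner_char_poly -det_mulmx; congr (\det _).
by rewrite mulmxBr mulmxN mulKVmx // opprK mul_mx_scalar addrC.
Qed.

Lemma pencil_at_mu n (M : tensor F n n 2) x :
  pencil_at M (mu0 x) (mu1 x) = pencil_at M 1 (- 'i%C) + x *: pencil_at M 1 'i%C.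
Proof.
rewrite /pencil_at /mu0 /mu1; apply/matrixP => i j; rewrite !mxE; ring.
Qed.

Definition pencil_path n (M E : tensor F n n 2) (t : F) a b : 'M[C]_n :=
  pencil_at M a b + t%:C *: pencil_at E a b.

Lemma pencil_pathE n (M E : tensor F n n 2) t a b k l :
  pencil_path M E t a b k l = pencil_at M a b k l + t%:C * pencil_at E a b k l.
Proof. by rewrite mxE [X in _ + X]mxE. Qed.

Lemma scaler_affine (K : comNzRingType) (V : lmodType K) (a b c d : V) (x t : K) :
  a + x *: b + t *: (c + x *: d) = a + t *: c + x *: (b + t *: d).
Proof. by rewrite !scalerDr !scalerA [t * x]mulrC addrACA. Qed.

Lemma pencil_path_mu n (M E : tensor F n n 2) t x :
  pencil_path M E t (mu0 x) (mu1 x) =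
  pencil_path M E t 1 (- 'i%C) + x *: pencil_path M E t 1 'i%C.
Proof.
rewrite /pencil_path (pencil_at_mu M x).
rewrite (pencil_at_mu E x).
exact: scaler_affine. Qed.

Lemma pencil_path_mulmx n (M E : tensor F n n 2) t a b (v : 'cV[C]_n) :
  pencil_path M E t a b *m v =
  pencil_at M a b *m v + t%:C *: pencil_at E a b *m v.
Proof. by rewrite /pencil_path mulmxDl. Qed.

Definition mu_vec (x : C) : 'cV[C]_2 :=
  \col_k (if k == 0 then mu0 x else mu1 x).

Lemma eigenvector_relation (K : fieldType) (V : lmodType K) (x y : V)
    (a b i c : K) : i * a - b = c -> c != 0 -> b *: x = a *: y ->
  x = a *: (c^-1 *: (i *: x - y)) /\ y = b *: (c^-1 *: (i *: x - y)).
Proof.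
move=> cE c0 h; split; rewrite scalerA [_ / _]mulrC -scalerA; apply: (scalerI c0);
  rewrite scalerA divff // scale1r scalerBr -{1}cE scalerBl.
  by rewrite h scalerA mulrC.
by rewrite scalerA [b * i]mulrC -[(i * b) *: x]scalerA h scalerA.
Qed.

Lemma mu_vecE x k : mu_vec x k 0 = if k == 0 then mu0 x else mu1 x.
Proof. by rewrite mxE. Qed.

Lemma i_mu_neq0 : (2 * 'i%C : C) != 0.
Proof. by rewrite mulf_neq0 ?pnatr_eq0 // eq_complex /= oner_eq0 andbF. Qed.

Lemma i_muE (x : C) : 'i%C * mu0 x - mu1 x = 2 * 'i%C.
Proof. by rewrite /mu0 /mu1; ring. Qed.

Lemma pencil_at_mulmx n (M : tensor F n n 2) a b (v : 'cV[C]_n) :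
  pencil_at M a b *m v = b *: (toC (M 0) *m v) - a *: (toC (M 1) *m v).
Proof. by rewrite /pencil_at mulmxBl -!scalemxAl. Qed.

(* A root x of the pencil yields the eigenvector relation Q_k v = mu_k q with
   2i q = (i Q_0 - Q_1) v. *)
Lemma gen_eigenvalue_mu n (Q : tensor F n n 2) x :
  pencil_at Q 1 'i%C \in unitmx -> \det (pencil_at Q (mu0 x) (mu1 x)) = 0 ->
  gen_eigenvalue (complexify Q) <[mu_vec x]>%VS.
Proof.
move=> uN /eqP /det0_colP [v v0 hv].
exists (mu_vec x); split=> //.
  apply/eqP => /colP h; move: (h 0) (h 1); rewrite !mu_vecE !mxE /= => m0 m1.
  by have := i_mu_neq0; rewrite -(i_muE x) m0 m1 mulr0 subr0 eqxx.
exists v, ((2 * 'i%C)^-1 *: (pencil_at Q 1 'i%C *m v)); split=> //.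
  rewrite scaler_eq0 invr_eq0 negb_or i_mu_neq0 /=.
  by apply: contra v0 => /eqP h; rewrite -[v](mulKmx uN) h mulmx0.
move: hv; rewrite !pencil_at_mulmx scale1r => /eqP; rewrite subr_eq0 => /eqP hv.
have [hX hY] := eigenvector_relation (i_muE x) i_mu_neq0 hv.
move=> k; rewrite ffunE mu_vecE; have [->|->] : k = 0 \/ k = 1 by
  case: k => -[|[|//]] p; [left|right]; apply: val_inj.
  exact: hX.
exact: hY.
Qed.

(** The form [i mu0 - mu1] takes the constant value [2i], so the two vectors cannot differ by a
    factor other than 1. *)
Lemma mu_line_inj x y :
  <[mu_vec x]>%VS =
  <[mu_vec y]>%VS :> {vspace 'cV[C]_2} ->
  x = y.
Proof.
set u := mu_vec x; set w := mu_vec y => h.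
have /vlineP [c uw] : u \in <[w]>%VS by rewrite -h memv_line.
move/colP: uw => uw.
have h0 : mu0 x = c * mu0 y by have := uw 0; rewrite [RHS]mxE /u /w !mu_vecE.
have h1 : mu1 x = c * mu1 y by have := uw 1; rewrite [RHS]mxE /u /w !mu_vecE.
have c1 : c = 1.
  by apply: (mulIf i_mu_neq0); rewrite mul1r -{2}(i_muE x) h0 h1 -(i_muE y); ring.
by move: h0; rewrite c1 mul1r /mu0 => /addrI.
Qed.

Lemma midf_itv (x y : F) : 0 <= x -> x < y ->
  [/\ 0 < (x + y) / 2, x < (x + y) / 2 & (x + y) / 2 < y].
Proof. by move=> x0 xy; split; lra. Qed.

Lemma sqr_lt_half (x y : F) : 0 <= x -> x < y / 2 -> 2 * x ^+ 2 < y ^+ 2 / 2.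
Proof.
move=> x0 xy; have : x ^+ 2 < (y / 2) ^+ 2 by rewrite ltr_pXn2r // nnegrE; lra.
by rewrite expr_div_n expr2; lra.
Qed.

(** For [x >= 1] the hypotheses give [x^2 - 4 x + 1 < 0], so [x < 2 + sqrt 3 < 4]. *)
Lemma radius_le4 (x y d : F) : 0 <= d <= 2^-1 -> 0 <= y ->
  y ^+ 2 < 2 * (1 + x ^+ 2) * d ^+ 2 -> x <= y + 1 -> x <= 4.
Proof.
move=> /andP[d0 d1] y0 hy xy; rewrite leNgt; apply/negP => x4.
have dd : d ^+ 2 <= 4^-1.
  have : d ^+ 2 <= 2^-1 ^+ 2 by rewrite ler_pXn2r // ?nnegrE; lra.
  by rewrite exprVn -natrX.
have : 2 * (1 + x ^+ 2) * d ^+ 2 <= 2 * (1 + x ^+ 2) * 4^-1.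
  by rewrite ler_wpM2l // mulr_ge0 // addr_ge0 // sqr_ge0.
have : (x - 1) ^+ 2 <= y ^+ 2 by rewrite ler_pXn2r // ?nnegrE; lra.
nra.
Qed.

Lemma chord_lt (x y z w : C) (d e : F) : chord x z < d -> chord y w < d ->
  nc (x - y) < e -> chord z w < e + 2 * d.
Proof.
move=> xz yw xy; have := chord_triangle x z w; have := chord_triangle y x w.
by have := chord_le x y; rewrite (chord_sym z x); lra.
Qed.

(** * Roots along the segment from [P] to [Q] *)

Section Fixed.
Variables (n J : nat) (A B : 'M[F]_n) (D : 'M[F]_(2, n)) (Q : tensor F n n 2).
Hypothesis D_unit : forall r, euclid_norm (col r D) = 1.
Hypothesis J_range : (1 <= J <= n)%N.
Local Notation P := (cpd_tensor A B D).
Local Notation sigma := (sigma_min A * sigma_min B).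
Local Notation delta := (nth_largest J (half_gaps D)).
Local Notation f := (Num.sqrt (frob2 (Q - P))).
Hypothesis close : f < sigma * delta.

Let s := sorted_columns D.

Let size_s : size s = n.
Proof. by rewrite size_sort size_map size_enum_ord. Qed.

Let s_unit lam : lam \in s -> euclid_norm lam = 1.
Proof. by move=> /mem_sorted_columns [r ->]. Qed.

Let nth_s_unit r : (r < n)%N -> euclid_norm (nth 0 s r) = 1.
Proof. by move=> rn; rewrite s_unit // mem_nth // size_s. Qed.

Let delta_bounds : 0 <= delta <= 2^-1.
Proof. exact: nth_largest_half_gaps. Qed.

Let f0 : 0 <= f. Proof. exact: sqrtr_ge0. Qed.

Let sigma_gt0 : 0 < sigma.
Proof.
have : 0 < sigma * delta by apply: le_lt_trans close.
move=> h; rewrite lt_def mulr_ge0 ?sigma_min_ge0 ?andbT //.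
by apply: contraTneq h => ->; rewrite mul0r ltxx.
Qed.

(** The midpoint leaves room on both sides: roots stay within [delta'] of the lines of [P], and
    [delta - delta'] is the slack that makes a positive step size possible. *)
Let delta' := (f / sigma + delta) / 2.

Let delta'_bounds : [/\ 0 < delta', delta' < delta & f < sigma * delta'].
Proof.
have fs : f / sigma < delta by rewrite ltr_pdivrMr // mulrC.
have fs0 : 0 <= f / sigma by rewrite divr_ge0 // ltW.
have [g0 g1 g2] := midf_itv fs0 fs.
by split=> //; rewrite mulrC -ltr_pdivrMr.
Qed.

Local Notation Mt := (pencil_path P (Q - P)).

Let Mt1 a b : Mt 1 a b = pencil_at Q a b.
Proof. by rewrite /pencil_path scale1r -pencil_atD addrC subrK. Qed.

Let Mt0 a b : Mt 0 a b = pencil_at P a b.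
Proof. by rewrite /pencil_path scale0r addr0. Qed.

Let perturb_le t a b v : 0 <= t <= 1 ->
  norm2 (t%:C *: pencil_at (Q - P) a b *m v) <=
  (nc a ^+ 2 + nc b ^+ 2) * f ^+ 2 * norm2 v.
Proof.
move=> /andP[t0 t1]; rewrite -scalemxAl norm2Z normc_real ger0_norm //.
rewrite [leRHS](_ : _ = 1 * ((nc a ^+ 2 + nc b ^+ 2) * frob2 (Q - P) * norm2 v)); last first.
  by rewrite mul1r sqr_sqrtr ?frob2_ge0.
by rewrite ler_pM ?sqr_ge0 ?norm2_ge0 ?pencil_at_le // expr_le1.
Qed.

(** At [(1 : i)] the determinant with any real unit vector has modulus 1, so [P] contributes
    [sigma ^+ 2]. The perturbation costs [2 * f ^+ 2], and the inequality [norm2D_le] halves the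
    constant. The result is positive since [f < sigma / 2]. *)
Let Nt_ge t v : 0 <= t <= 1 ->
  (sigma ^+ 2 / 2 - 2 * f ^+ 2) * norm2 v <= norm2 (Mt t 1 'i%C *m v).
Proof.
move=> ht; have hE := perturb_le 1 'i%C v ht.
rewrite normc_i Normc.normc1 !expr1n in hE.
have hP : sigma ^+ 2 * 1 * norm2 v <= norm2 (pencil_at P 1 'i%C *m v).
  apply: pencil_at_cpd_ge => // r; have l1 := D_unit r.
  have u1 : nc (col r D 0 0 -i* col r D 1 0) = 1 by exact: normc_unit.
  rewrite !mxE in u1; rewrite mul1r.
  have -> : 'i%C * (D 0 r)%:C - (D 1 r)%:C = 'i%C * ((D 0 r)%:C + 'i%C * (D 1 r)%:C).
    by rewrite mulrDr mulrA -expr2 sqr_i mulN1r.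
  have -> : (D 0 r)%:C + 'i%C * (D 1 r)%:C = D 0 r +i* D 1 r.
    by apply/eqP; rewrite eq_complex /=; apply/andP; split; apply/eqP; ring.
  by rewrite Normc.normcM normc_i mul1r sqr_normcE -[D 1 r ^+ 2]sqrrN -sqr_normcE u1 expr1n.
have : norm2 (pencil_at P 1 'i%C *m v) <=
    2 * (norm2 (Mt t 1 'i%C *m v) + norm2 (t%:C *: pencil_at (Q - P) 1 'i%C *m v)).
  have -> : pencil_at P 1 'i%C *m v = Mt t 1 'i%C *m v + - (t%:C *: pencil_at (Q - P) 1 'i%C *m v).
    by rewrite pencil_path_mulmx addrK.
  by apply: le_trans (norm2D_le _ _) _; rewrite norm2N.
move=> h; rewrite mulrBl lerBlDr -(ler_pM2l (ltr0Sn F 1)).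
rewrite mulrA [2 * (_ / 2)]mulrC divfK ?pnatr_eq0 // -[sigma ^+ 2]mulr1.
apply: le_trans hP (le_trans h _); rewrite ler_wpM2l // lerD2l.
by apply: le_trans hE _; rewrite -[1 + 1]/2.
Qed.

Let lead_low := sigma ^+ 2 / 2 - 2 * f ^+ 2.

Let lead_low_gt0 : 0 < lead_low.
Proof.
have [d0 d1 fs] := delta'_bounds; have [/andP[dl0 dl1]] := delta_bounds.
rewrite /lead_low.
have h : f < sigma / 2.
  by apply: lt_le_trans close _; rewrite ler_wpM2l // ltW.
by rewrite subr_gt0 sqr_lt_half.
Qed.

Let Nt_unit t : 0 <= t <= 1 -> Mt t 1 'i%C \in unitmx.
Proof.
move=> ht; rewrite unitmxE unitfE; apply/negP => /det0_colP [v v0 hv].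
have := Nt_ge v ht; rewrite hv.
have -> : norm2 (0 : 'cV[C]_n) = 0 by apply/eqP; rewrite norm2_eq0.
rewrite leNgt => /negP []; rewrite mulr_gt0 // ?lead_low_gt0 //.
by rewrite lt_neqAle norm2_ge0 eq_sym norm2_eq0 v0.
Qed.

Let q t x := \det (Mt t (mu0 x) (mu1 x)).

Let qE t x : 0 <= t <= 1 -> q t x = \det (Mt t 1 'i%C) *
  (char_poly (- (invmx (Mt t 1 'i%C) *m Mt t 1 (- 'i%C)))).[x].
Proof.
move=> ht.
by rewrite /q (pencil_path_mu P (Q - P) t x) (det_affine _ _ (Nt_unit ht)).
Qed.

(** Bauer-Fike: on a kernel vector the pencil of [P] and the perturbation cancel, so the lower bound
    for the one cannot exceed the upper bound for the other. Both carry the factor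
    [2 * (1 + nc x ^+ 2)]. *)
Let root_near t x : 0 <= t <= 1 -> q t x = 0 ->
  exists r, nc (x - circle_pt (col r D)) ^+ 2 < 2 * (1 + nc x ^+ 2) * delta' ^+ 2.
Proof.
move=> ht /eqP /det0_colP [v v0 hv].
have v_gt0 : 0 < norm2 v by rewrite lt_neqAle norm2_ge0 eq_sym norm2_eq0 v0.
have [d0 d1 fs] := delta'_bounds.
have w0 : 0 < 1 + nc x ^+ 2 by rewrite ltr_pwDl ?sqr_ge0.
apply/existsP; apply: contraT; rewrite negb_exists => /forallP h.
have hP : sigma ^+ 2 * (2 * (1 + nc x ^+ 2) * delta' ^+ 2) * norm2 v <=
    norm2 (pencil_at P (mu0 x) (mu1 x) *m v).
  apply: pencil_at_cpd_ge; first by rewrite mulr_ge0 ?sqr_ge0 // mulr_ge0 // ltW.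
  move=> r; have := h r; rewrite -leNgt -(normc_pencil_at_circle _ (D_unit r)).
  by rewrite !mxE.
have := perturb_le (mu0 x) (mu1 x) v ht.
have -> : t%:C *: pencil_at (Q - P) (mu0 x) (mu1 x) *m v =
    - (pencil_at P (mu0 x) (mu1 x) *m v).
  by apply/eqP; rewrite -addr_eq0 addrC -pencil_path_mulmx hv.
rewrite norm2N sqr_normc_mu => hE; have := le_trans hP hE.
rewrite ler_pM2r // mulrCA ler_pM2l ?mulr_gt0 // -exprMn.
by rewrite leNgt ltr_pXn2r ?fs // nnegrE // mulr_ge0 // ltW.
Qed.

Let root_bound t x : 0 <= t <= 1 -> q t x = 0 -> nc x <= 4.
Proof.
move=> ht /(root_near ht) [r hr].
have [d0 d1 fs] := delta'_bounds; have [/andP[dl0 dl1]] := delta_bounds.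
have z1 := normc_circle_pt (D_unit r).
have tri : nc x <= nc (x - circle_pt (col r D)) + 1.
  by rewrite -z1 -{1}[x](subrK (circle_pt (col r D))) le_normcD.
apply: radius_le4 (normc_ge0 _) hr tri.
by rewrite (ltW d0) (le_trans (ltW d1)).
Qed.

Let root_chord t x : 0 <= t <= 1 -> q t x = 0 ->
  exists2 r, (r < n)%N & chord x (circle_pt (nth 0 s r)) < delta'.
Proof.
move=> ht /(root_near ht) [r hr]; have [d0 d1 fs] := delta'_bounds.
have rs : col r D \in s by rewrite /s /sorted_columns mem_sort; apply: map_f; rewrite mem_enum.
exists (index (col r D) s).
  by rewrite -[X in (_ < X)%N]size_s index_mem.
rewrite nth_index // /chord ltr_pdivrMr ?mulr_gt0 ?sphere_scale_gt0 //.
have w0 : 0 <= delta' * (sphere_scale x * sphere_scale (circle_pt (col r D))).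
  by rewrite mulr_ge0 ?(ltW d0) // mulr_ge0 // ltW // sphere_scale_gt0.
rewrite -ltr_sqr ?nnegrE ?normc_ge0 //.
apply: lt_le_trans hr _; rewrite !exprMn !sqr_sphere_scale normc_circle_pt ?D_unit // expr1n.
by rewrite le_eqVlt; apply/orP; left; apply/eqP; ring.
Qed.

(** For [nc x <= 4] both coordinates of the point have modulus at most 5, so this bounds all entries
    along the path as well as their Lipschitz constants in [t]. The summand 1 provides [1 <= B] in
    [det_lipschitz]. *)
Let path_bound : F :=
  1 + \sum_i \sum_j 5 * (`|P 0 i j| + `|P 1 i j| + (`|(Q - P) 0 i j| + `|(Q - P) 1 i j|)).

Let path_bound_ge1 : 1 <= path_bound.
Proof.
rewrite lerDl sumr_ge0 // => i _; rewrite sumr_ge0 // => j _.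
by rewrite mulr_ge0 // !addr_ge0.
Qed.

Let entries_le i j :
  5 * (`|P 0 i j| + `|P 1 i j|) + 5 * (`|(Q - P) 0 i j| + `|(Q - P) 1 i j|) <= path_bound.
Proof.
rewrite -mulrDr /path_bound (bigD1 i) //= (bigD1 j) //=.
set X := 5 * _; rewrite addrCA -addrA lerDl addr_ge0 //; last first.
  rewrite addr_ge0 // sumr_ge0 // => k _; rewrite ?sumr_ge0 // => *.
  by rewrite ?sumr_ge0 ?mulr_ge0 ?addr_ge0.
by rewrite sumr_ge0 // => k _; rewrite mulr_ge0 // !addr_ge0.
Qed.

Let mu_le x : nc x <= 4 -> nc (mu0 x) <= 5 /\ nc (mu1 x) <= 5.
Proof.
have e : (5 : F) = 1 + 4 by ring.
move=> hx; split; rewrite e /mu0 /mu1.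
  by apply: le_trans (le_normcD _ _) _; rewrite Normc.normc1 lerD2l.
rewrite Normc.normcM normc_i mul1r addrC.
by apply: le_trans (le_normcD _ _) _; rewrite normcN Normc.normc1 lerD2l.
Qed.

Let path_entry_le t x i j : 0 <= t <= 1 -> nc x <= 4 ->
  nc (Mt t (mu0 x) (mu1 x) i j) <= path_bound.
Proof.
move=> /andP[t0 t1] /mu_le [a5 b5]; apply: le_trans (entries_le i j).
rewrite pencil_pathE.
apply: le_trans (le_normcD _ _) _; rewrite Normc.normcM normc_real ger0_norm //.
apply: lerD; first exact: pencil_at_entry_le.
rewrite -[leRHS]mul1r ler_pM ?normc_ge0 //; exact: pencil_at_entry_le.
Qed.

Let path_entry_lipschitz t t' x i j : nc x <= 4 ->
  nc (Mt t (mu0 x) (mu1 x) i j - Mt t' (mu0 x) (mu1 x) i j) <=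
  path_bound * `|t - t'|.
Proof.
move=> /mu_le [a5 b5].
have -> : Mt t (mu0 x) (mu1 x) i j - Mt t' (mu0 x) (mu1 x) i j =
    (t - t')%:C * pencil_at (Q - P) (mu0 x) (mu1 x) i j.
  by rewrite !pencil_pathE rmorphB mulrBl opprD addrACA subrr add0r.
rewrite Normc.normcM normc_real mulrC ler_wpM2r //.
apply: le_trans (pencil_at_entry_le _ _ _ a5 b5) _.
apply: le_trans (entries_le i j); rewrite lerDr.
by rewrite mulr_ge0 // addr_ge0.
Qed.

Local Notation cl := (cluster s (2 * delta)).

Let good (c : nat) (x : C) : Prop :=
  exists2 r, (r < n)%N /\ cl r = c & chord x (circle_pt (nth 0 s r)) < delta'.

(** The two nearby lines are at distance less than [2 * (delta - delta') + 2 * delta' = 2 * delta],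
    whereas different clusters are at least [2 * delta] apart. *)
Let good_close x y c c' : good c x -> good c' y ->
  nc (x - y) < 2 * (delta - delta') -> c = c'.
Proof.
move=> [r [rn <-] hr] [r' [rn' <-] hr'] xy; apply/eqP.
have := chord_lt hr hr' xy; rewrite mulrBr subrK.
rewrite chord_circle_pt ?nth_s_unit //.
apply: contraLR => ne; rewrite -leNgt; apply: cluster_separated; rewrite ?size_s //.
by apply: sort_sorted => lam mu; exact: le_total.
Qed.

Let root0 i : (i < n)%N -> q 0 (circle_pt (nth 0 s i)) = 0.
Proof.
move=> i_n; rewrite /q Mt0 pencil_at_cpd !det_mulmx det_diag.
have /mem_sorted_columns [r ->] : nth 0 s i \in s by rewrite mem_nth ?size_s.
rewrite [X in _ * X * _](_ : _ = 0) ?mulr0 ?mul0r //.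
apply/eqP/prodf_eq0; exists r => //; rewrite mxE.
have := normc_pencil_at_circle (circle_pt (col r D)) (D_unit r).
by rewrite subrr Normc.normc0 !mxE => /eqP; rewrite normc_eq0.
Qed.

Let tracked i : (i < n)%N -> exists2 x, q 1 x = 0 & good (cl i) x.
Proof.
move=> i_n; have [d0 d1 _] := delta'_bounds.
have eta0 : 0 < 2 * (delta - delta') by rewrite mulr_gt0 // subr_gt0.
pose L : F := #|{: {perm 'I_n}}|%:R * (n%:R * path_bound ^+ n * path_bound).
(* The square root appears because [normc_det_ge] bounds the squared modulus of the leading
   coefficient. *)
apply: (@root_tracking _ q _ n (Num.sqrt (lead_low ^+ n)) L (2 * (delta - delta'))) => //.
- by rewrite sqrtr_gt0 exprn_gt0 // lead_low_gt0.
- move=> t ht; exists (char_poly (- (invmx (Mt t 1 'i%C) *m Mt t 1 (- 'i%C)))).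
  split; [exact: char_poly_monic | exact: size_char_poly |].
  exists (\det (Mt t 1 'i%C)); last by move=> x; exact: qE.
  rewrite -(ger0_norm (normc_ge0 _)) -sqrtr_sqr ler_wsqrtr //.
  by apply: normc_det_ge => [|v]; [exact: ltW lead_low_gt0 | exact: Nt_ge].
- move=> t t' x ht ht' qx; have x4 := root_bound ht qx.
  have qx0 : \det (Mt t (mu0 x) (mu1 x)) = 0 := qx.
  rewrite -[q t' x]subr0 -qx0 /q.
  rewrite distrC /L -!mulrA.
  apply: le_trans (det_lipschitz (B := path_bound) (e := path_bound * `|t' - t|) _ _ _ _ _) _.
  + exact: path_bound_ge1.
  + by rewrite mulr_ge0 // (le_trans ler01 path_bound_ge1).
  + by move=> *; exact: path_entry_le.
  + by move=> *; exact: path_entry_le.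
  + by move=> *; exact: path_entry_lipschitz.
  + by rewrite -!mulrA.
(* The new root is near some line of [P]; being close to the old root, it belongs to the same
   cluster. *)
- move=> t t' x y ht ht' qx qy xy gx.
  have [r rn hr] := root_chord ht' qy.
  have gy : good (cl r) y by exists r.
  by rewrite (good_close gx gy xy).
- exists (circle_pt (nth 0 s i)); first exact: root0.
  exists i => //; apply: le_lt_trans (chord_le _ _) _.
  by rewrite subrr Normc.normc0.
Qed.

Let big := filter (big_gap s (2 * delta)) (iota 0 (size s)).

Let size_big : (J <= size big)%N.
Proof.
rewrite size_filter size_s.
have -> d : count (big_gap s (2 * d)) (iota 0 n) =
    count (fun x => d <= x) (half_gaps D).
  rewrite -[half_gaps D](mkseq_nth 0) /mkseq size_half_gaps count_map.
  apply: eq_in_count => i; rewrite mem_iota add0n /= => i_n.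
  by rewrite half_gaps_nth // /big_gap size_s ler_pdivlMr // mulrC.
by apply: nth_largest_count; rewrite size_half_gaps.
Qed.

Lemma perturbed_gen_eigenvalues : at_least_gen_eigenvalues J (complexify Q).
Proof.
have t1 : 0 <= (1 : F) <= 1 by rewrite ler01 lexx.
(* One root at [Q] is chosen for each cluster, represented by the line before its closing big gap.
   Equal roots force equal clusters, hence equal representatives. *)
pose x i := xget 0 [set x : C | q 1 x = 0 /\ good (cl i) x]%classic.
have xP i : i \in big -> q 1 (x i) = 0 /\ good (cl i) (x i).
  rewrite mem_filter mem_iota size_s add0n => /andP[_ i_n].
  have [y qy gy] := tracked i_n.
  exact: (@xgetPex _ (0 : C) [set z : C | q 1 z = 0 /\ good (cl i) z]%classic
    (ex_intro _ y (conj qy gy))).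
exists [seq <[mu_vec (x i)]>%VS | i <- big]; split.
- rewrite map_inj_in_uniq ?filter_uniq ?iota_uniq // => i j hi hj /mu_line_inj xij.
  have [_ gi] := xP i hi; have [_ gj] := xP j hj.
  apply: (cluster_big_gap_inj hi hj); apply: (good_close gi gj).
  have [d0 d1 _] := delta'_bounds.
  by rewrite xij subrr Normc.normc0 mulr_gt0 // subr_gt0.
- by rewrite size_map size_big.
- move=> L /mapP [i /xP [qx _] ->]; apply: gen_eigenvalue_mu.
    by rewrite -Mt1 Nt_unit.
  by rewrite -Mt1.
Qed.

End Fixed.
End Perturbation.

(** * Pairs of slices *)

Section SlicePairs.
Variable F : realType.

Lemma spectral_norm_ge0 m n p (M : tensor F[i]%C m n p) : 0 <= spectral_norm M.
Proof.
rewrite /spectral_norm; set E := mkset _.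
have E0 t : E t -> 0 <= t by move=> [x [y [z [_ _ _ ->]]]]; exact: normc_ge0.
(* A set without a supremum has [sup] equal to 0. *)
have [h|/sup_out -> //] := boolp.pselect (has_sup E).
by have [[t Et] ub] := h; apply: le_trans (E0 t Et) (ub_le_sup ub Et).
Qed.

Lemma dist_not_slice_mix_invertible_ge0 n (P : tensor F n n 2) :
  0 <= dist_not_slice_mix_invertible P.
Proof.
rewrite /dist_not_slice_mix_invertible; set E := image _ _.
have [->|/set0P E0] := eqVneq E set0; first by rewrite inf0.
by apply: lb_le_inf => // _ [Q _ <-]; exact: spectral_norm_ge0.
Qed.

Lemma frob2_mode3 m n p (M : tensor F m n p) (U : 'M[F]_p) :
  U *m U^T = 1%:M -> frob2 (mode3 M U) = frob2 M.
Proof.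
move=> /mulmx1C UU; rewrite /frob2 exchange_big [RHS]exchange_big /=.
apply: eq_bigr => i _; rewrite exchange_big [RHS]exchange_big /=.
apply: eq_bigr => j _; pose x : 'cV[F]_p := \col_k M k i j.
have xE (y : 'cV[F]_p) : \sum_k y k 0 ^+ 2 = (y^T *m y) 0 0.
  by rewrite mxE; apply: eq_bigr => k _; rewrite !mxE expr2.
transitivity (\sum_k (U *m x) k 0 ^+ 2).
  apply: eq_bigr => k _; rewrite !mxE ffunE summxE; congr (_ ^+ 2).
  by apply: eq_bigr => l _; rewrite !mxE.
rewrite xE trmx_mul mulmxA -(mulmxA _ U^T) UU mulmx1 -xE.
by apply: eq_bigr => k _; rewrite mxE.
Qed.

(** The slice indices [2 k + a] are pairwise different; for odd [p] the last slice is left over,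
    hence only an inequality. *)
Lemma frob2_slice_pairs_le m n p (M : tensor F m n p) :
  \sum_(k < p./2) frob2 (slice_pair M k) <= frob2 M.
Proof.
pose g l := \sum_i \sum_j M l i j ^+ 2.
have g0 l : 0 <= g l by do 2!(rewrite sumr_ge0 // => ? _); rewrite sqr_ge0.
pose h (x : 'I_p./2 * 'I_2) := Ordinal (slice_pair_subproof x.1 x.2).
have h_inj : injective h.
  move=> [k a] [l b] /(congr1 val) /= e.
  have hk : k = l.
    by apply: val_inj => /=; move: e (ltn_ord a) (ltn_ord b); lia.
  by move: e; rewrite hk => /addnI /val_inj ->.
have -> : \sum_(k < p./2) frob2 (slice_pair M k) = \sum_x g (h x).
  rewrite pair_big /=.
  by apply: eq_bigr => -[k a] _; rewrite /frob2 ffunE.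
rewrite -(big_imset g (in2W h_inj)) /=; set S := (X in \sum_(j in X) g j).
rewrite /frob2 -/(\sum_l g l) [leRHS](bigID (mem S)) /=.
by rewrite lerDl sumr_ge0.
Qed.

Lemma mode3B m n p l (M N : tensor F m n p) (U : 'M[F]_(l, p)) :
  mode3 (M - N) U = mode3 M U - mode3 N U.
Proof.
apply/ffunP => k; rewrite !ffunE -sumrB; apply: eq_bigr => j _.
by rewrite !ffunE scalerBr.
Qed.

Lemma slice_pairB m n p (M N : tensor F m n p) k :
  slice_pair (M - N) k = slice_pair M k - slice_pair N k.
Proof. by apply/ffunP => j; rewrite !ffunE. Qed.

(** The matrix consists of two rows of the orthogonal [U]; its transpose is a right inverse, so the
    rank is 2. *)
Lemma subpencil_slice_pair m n p (M : tensor F m n p) (U : 'M[F]_p) k :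
  U *m U^T = 1%:M -> subpencil (slice_pair (mode3 M U) k) M.
Proof.
move=> UU; pose f j := Ordinal (slice_pair_subproof k j).
exists (rowsub f U); last first.
  by apply/ffunP => j; rewrite !ffunE; apply: eq_bigr => l _; rewrite !mxE.
apply/eqP; rewrite -/(row_free _); apply/row_freeP; exists (rowsub f U)^T.
apply/matrixP => a b; have /matrixP/(_ (f a) (f b)) := UU; rewrite !mxE => UUab.
transitivity ((f a == f b)%:R : F); last by rewrite -val_eqE /= eqn_add2l.
by rewrite -UUab; apply: eq_bigr => l _; rewrite !mxE.
Qed.

Lemma frobenius_norm_lt_pencil n K (M : tensor F n n K) (e : 'cV[F]_(K./2)) :
  frobenius_norm M < euclid_norm e ->
  exists k, frob2 (slice_pair M k) < e k 0 ^+ 2.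
Proof.
move=> h; apply/existsP; apply: contraLR h; rewrite negb_exists -leNgt => /forallP h.
rewrite ler_wsqrtr // -/(frob2 M); apply: le_trans (frob2_slice_pairs_le M).
by apply: ler_sum => k _; rewrite leNgt.
Qed.

Lemma J_eigenvalue_bound_gen_eigenvalues n J (P Q : tensor F n n 2) e :
  (1 <= J <= n)%N -> J_eigenvalue_bound J P e -> frob2 (P - Q) < e ^+ 2 ->
  at_least_gen_eigenvalues J (complexify Q).
Proof.
move=> hJ [[_ [A [B [C [[_ ->] C1 ->]]]]]|[_ ->]]; last first.
  by rewrite expr0n ltNge frob2_ge0.
set e1 := _ * _; set d := dist_not_slice_mix_invertible _ => h.
have frobN : frob2 (Q - cpd_tensor A B C) = frob2 (cpd_tensor A B C - Q).
  apply: eq_bigr => k _; apply: eq_bigr => i _; apply: eq_bigr => j _.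
  by rewrite -opprB ffunE mxE sqrrN.
have e10 : 0 <= e1.
  rewrite !mulr_ge0 ?sigma_min_ge0 //.
  by have /andP[] := nth_largest_half_gaps C1 hJ.
(* The hypothesis bounds a square by [e ^+ 2]; the sign of [e] is needed to take roots. *)
have m0 : 0 <= Num.min e1 d by rewrite le_min e10 dist_not_slice_mix_invertible_ge0.
apply: (perturbed_gen_eigenvalues (A := A) (B := B) C1 hJ).
rewrite frobN -/e1; apply: lt_le_trans (_ : Num.min e1 d <= e1); last by rewrite ge_min lexx.
rewrite -[ltRHS]ger0_norm // -sqrtr_sqr ltr_sqrt //.
by apply: le_lt_trans h; exact: frob2_ge0.
Qed.

End SlicePairs.

Unset Implicit Arguments.

Theorem corollary3p5 (F : realType) (R K J : nat)
    (T : tensor F R R K)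
    (T_smi : slice_mix_invertible T)
    (T_rank : tensor_rank T R)
    (J_range : (1 <= J <= R)%N)
    (U : 'M[F]_K)
    (U_orth : U *m U^T = 1%:M)
    (eps : 'cV[F]_(K./2))
    (eps_bound : forall k : 'I_(K./2),
       J_eigenvalue_bound J (slice_pair (mode3 T U) k) (eps k 0))
    (Y : tensor F R R K)
    (TY : frobenius_norm (T - Y) < euclid_norm eps) :
  exists2 P : tensor F R R 2, subpencil P Y &
    at_least_gen_eigenvalues J (complexify P).
Proof.
have TYU : frobenius_norm (mode3 (T - Y) U) < euclid_norm eps.
  by rewrite /frobenius_norm -/(frob2 _) frob2_mode3.
have [k hk] := frobenius_norm_lt_pencil TYU.
exists (slice_pair (mode3 Y U) k); first exact: subpencil_slice_pair.
apply: J_eigenvalue_bound_gen_eigenvalues J_range (eps_bound k) _.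
by rewrite -slice_pairB -mode3B.
Qed.
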